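(* Let $n \ge 1$ and let $\equiv$ be a simple essential lattice congruence of the weak order on $\mathfrak{S}_n$. Then the Hasse diagrams of the $\equiv$-posets are precisely the $\equiv$-admissible separating trees.
   Context: Notation: $[n]=\{1,\dots,n\}$ and $]i,j[\,=\{i+1,\dots,j-1\}$ for $i<j$. The weak order on the permutations $\mathfrak{S}_n$ of $[n]$ is the lattice defined by $\sigma\le\tau$ iff $\mathrm{inv}(\sigma)\subseteq\mathrm{inv}(\tau)$, where $\mathrm{inv}(\sigma)=\{(\sigma_p,\sigma_q) : p<q,\ \sigma_p>\sigma_q\}$. A lattice congruence is an equivalence relation $\equiv$ on $\mathfrak{S}_n$ compatible with meets and joins; its classes are intervals. Arcs. An arc is a quadruple $(i,j,A,B)$ with $1\le i<j\le n$ and $A\sqcup B={]i,j[}$; $\mathcal{A}_n$ is the set of all arcs. The up arc is $u(i,j)=(i,j,]i,j[,\varnothing)$ and the down arc is $d(i,j)=(i,j,\varnothing,]i,j[)$. The arc $(i,j,A,B)$ is a subarc of $(i',j',A',B')$ if $i'\le i<j\le j'$, $A\subseteq A'$ and $B\subseteq B'$. For an arc $\alpha=(i,j,A,B)$ let $\sigma_\alpha$ be the permutation with a single descent whose one-line notation is $1,\dots,i-1$, then the elements of $A$ in increasing order, then $j$, then $i$, then the elements of $B$ in increasing order, then $j+1,\dots,n$. For a lattice congruence $\equiv$, let $\mathcal{A}_\equiv$ be the set of arcs $\alpha$ such that $\sigma_\alpha$ is the minimum of its $\equiv$-class. (The map $\equiv\ \mapsto\mathcal{A}_\equiv$ is a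 bijection from the lattice congruences of the weak order on $\mathfrak{S}_n$ to the subsets of $\mathcal{A}_n$ closed under taking subarcs.) The congruence $\equiv$ is essential if $\mathcal{A}_\equiv$ contains all arcs $(i,i+1,\varnothing,\varnothing)$, $i\in[n-1]$. It is simple if every arc of $\mathcal{A}_n\setminus\mathcal{A}_\equiv$ having no strict subarc in $\mathcal{A}_n\setminus\mathcal{A}_\equiv$ is an up arc or a down arc. $\equiv$-posets. A linear extension of a poset $\preccurlyeq$ on $[n]$ is a permutation $\sigma\in\mathfrak{S}_n$ such that $i\preccurlyeq j$ implies $\sigma^{-1}(i)\le\sigma^{-1}(j)$. Each $\equiv$-class is the set of all linear extensions of a unique poset on $[n]$; the posets obtained this way are the $\equiv$-posets. The Hasse diagram of a poset is the directed graph with an edge $i\to j$ for each cover relation $i\prec j$. Separating trees. In a directed tree $T$ (an orientation of a tree), the parents (resp. children) of a node $j$ are the targets of its outgoing edges (resp. the sources of its incoming edges), and the ancestor (resp. descendant) subtrees of $j$ are the connected components of $T\setminus j$ containing its parents (resp. children). A separating tree is a directed tree on $[n]$ in which each node has at most two parents and at most two children, and whenever a node $j$ has two parents (resp. two children), all nodes of one of its two ancestor (resp. descendant) subtrees are smaller than $j$ and all nodes of the other one are larger than $j$. For sets of integers, $L<R$ means that every element of $L$ is smaller than every element of $R$. Admissibility. The mandatory arcs of a separating tree $T$ are the arcs $(i,k,A,B)$ where $i<k$ are the endpoints of an edge of $T$ (in either direction) and $A$ (resp. $B$) is the set of nodes $j\in{]i,k[}$ such that $T$ has a directed path from $j$ to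 an endpoint of this edge (resp. from an endpoint of this edge to $j$). The forbidden up (resp. down) arcs of $T$ are the arcs $u(\max L,\min R)$ (resp. $d(\max L,\min R)$) where $L<R$ are two ancestor (resp. descendant) subtrees of a node of $T$. A separating tree $T$ is $\equiv$-admissible if $\mathcal{A}_\equiv$ contains all mandatory arcs of $T$ and none of the forbidden (up or down) arcs of $T$. *)

(* Defs.v *)
(** The ground set [n] = {1, ..., n} is represented by 'I_n,
    that is {0, ..., n-1}; every notion below only uses the linear order. *)
From HB Require Import structures.
From mathcomp Require Import all_boot all_fingroup.

Set Implicit Arguments.
Unset Strict Implicit.
Unset Printing Implicit Defensive.

Section WeakOrder.
Variable n : nat.
Implicit Types (s t m : 'S_n) (E : rel 'S_n).

Definition inv_set s : {set 'I_n * 'I_n} :=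
  [set (s pq.1, s pq.2) | pq : 'I_n * 'I_n & (pq.1 < pq.2) && (s pq.2 < s pq.1)].

Definition weak_le s t : bool := inv_set s \subset inv_set t.

Definition is_meet s t m : Prop :=
  [/\ weak_le m s, weak_le m t
    & forall x, weak_le x s -> weak_le x t -> weak_le x m].

Definition is_join s t m : Prop :=
  [/\ weak_le s m, weak_le t m
    & forall x, weak_le s x -> weak_le t x -> weak_le m x].

(** The weak order is a lattice, so the meets and joins quantified over here
    exist and are unique. *)
Definition lattice_congruence E : Prop :=
  [/\ equivalence_rel E,
      forall s s' t t' m m', E s s' -> E t t' ->
        is_meet s t m -> is_meet s' t' m' -> E m m'
    & forall s s' t t' m m', E s s' -> E t t' ->
        is_join s t m -> is_join s' t' m' -> E m m'].

Definition is_class_min E s : bool := [forall t, E s t ==> weak_le s t].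

End WeakOrder.

Section Arcs.
Variable n : nat.
Implicit Types (i j : 'I_n) (A B : {set 'I_n}) (E : rel 'S_n).

Definition open_itv i j : {set 'I_n} := [set k : 'I_n | i < k < j].

Definition quadruple : Type := 'I_n * 'I_n * {set 'I_n} * {set 'I_n}.
Implicit Types a b : quadruple.

Definition is_arc a : bool :=
  let: (i, j, A, B) := a in
  [&& i < j, A :|: B == open_itv i j & [disjoint A & B]].

Definition up_arc i j : quadruple := (i, j, open_itv i j, set0).
Definition down_arc i j : quadruple := (i, j, set0, open_itv i j).

Definition subarc a b : bool :=
  let: (i, j, A, B) := a in
  let: (i', j', A', B') := b in
  [&& i' <= i, i < j, j <= j', A \subset A' & B \subset B'].

Definition one_line (s : 'S_n) : seq 'I_n := [seq s p | p <- enum 'I_n].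

(** [enum A] lists the elements of [A : {set 'I_n}] in increasing order. *)
Definition arc_word a : seq 'I_n :=
  let: (i, j, A, B) := a in
  [seq k : 'I_n <- enum 'I_n | k < i] ++ enum A ++ [:: j; i] ++ enum B
    ++ [seq k : 'I_n <- enum 'I_n | j < k].

(** Specified by [one_line_arc_perm] on arcs; arbitrary on other quadruples. *)
Definition arc_perm a : 'S_n :=
  odflt 1%g [pick s : 'S_n | one_line s == arc_word a].

Definition arcs_of E : {set quadruple} :=
  [set a | is_arc a && is_class_min E (arc_perm a)].

Definition essential E : Prop :=
  forall i j, j = i.+1 :> nat -> (i, j, set0, set0) \in arcs_of E.

Definition simple_congruence E : Prop :=
  forall a, is_arc a -> a \notin arcs_of E ->
    (forall b, is_arc b -> subarc b a -> b != a -> b \in arcs_of E) ->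
  exists i j, a = up_arc i j \/ a = down_arc i j.

End Arcs.

Lemma perm_arc_word n (a : quadruple n) :
  is_arc a -> perm_eq (arc_word a) (enum 'I_n).
Proof.
case: a => [[[i j] A] B] /and3P[ij /eqP AB dAB].
have inAB x : (x \in A) || (x \in B) = (i < x < j).
  by rewrite -in_setU AB inE.
have inA x : x \in A -> i < x < j by move=> xA; rewrite -inAB xA.
have inB x : x \in B -> i < x < j by move=> xB; rewrite -inAB xB orbT.
have memE C (x : 'I_n) : (x \in enum C) = (x \in C) by exact: mem_enum.
have mem_ord P (x : 'I_n) : (x \in [seq k : 'I_n <- enum 'I_n | P k]) = P x.
  by rewrite mem_filter memE andbT.
have word_i (x : 'I_n) : x \in arc_word (i, j, A, B).
  rewrite /arc_word !mem_cat !memE !mem_ord !in_cons in_nil orbF.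
  have [->|xi] := eqVneq x i; first by rewrite !orbT.
  have [->|xj] := eqVneq x j; first by rewrite !orbT.
  have /orP[->//|ix] : (x < i) || (i < x) by rewrite -neq_ltn.
  have /orP[xltj|->] : (x < j) || (j < x) by rewrite -neq_ltn.
    by have := inAB x; rewrite ix xltj => /orP[]->; rewrite ?orbT.
  by rewrite !orbT.
have word_u : uniq (arc_word (i, j, A, B)).
  rewrite /arc_word.
  have uE C : uniq (enum C) by exact: enum_uniq.
  have uF (P : pred 'I_n) : uniq [seq k : 'I_n <- enum 'I_n | P k].
    exact/filter_uniq/enum_uniq.
  have asym (p q : nat) : p < q -> q < p -> false by case: ltngtP.
  have hF (s1 s2 : seq 'I_n) :
      (forall x, x \in s2 -> x \in s1 -> false) -> has (mem s1) s2 = false.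
    by move=> h; apply/negbTE/hasPn => x /h xs1; apply/negP => /xs1.
  rewrite !cat_uniq !uE !uF !has_cat !hF ?orbF /=.
  - by rewrite inE -(inj_eq val_inj) /= gtn_eqF.
  - by move=> x; rewrite mem_ord memE => jx /inB/andP[_ /asym->].
  - move=> x; rewrite mem_ord !inE => jx /orP[]/eqP xE; move: jx.
      by rewrite xE ltnn.
    by rewrite xE => /asym->.
  - move=> x; rewrite memE !inE => /inB/andP[ix xj] /orP[]/eqP xE; move: ix xj.
      by rewrite xE ltnn.
    by rewrite xE ltnn.
  - by move=> x; rewrite mem_ord memE => jx /inA/andP[_ /asym->].
  - by move=> x; rewrite !memE => xB; rewrite (disjointFl dAB xB).
  - move=> x; rewrite memE !inE => /orP[]/eqP-> /inA; last by rewrite ltnn.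
    by rewrite ltnn andbF.
  - move=> x; rewrite !mem_ord => jx xi.
    by have := ltn_trans (ltn_trans jx xi) ij; rewrite ltnn.
  - by move=> x; rewrite mem_ord memE => /inB/andP[/asym].
  - move=> x; rewrite mem_ord !inE => /orP[]/eqP->; last by rewrite ltnn.
    by move/asym->.
  - by move=> x; rewrite mem_ord memE => /inA/andP[/asym].
apply: uniq_perm => //; first exact: enum_uniq.
by move=> x; rewrite memE word_i.
Qed.

Lemma one_line_arc_perm n (a : quadruple n) :
  is_arc a -> one_line (arc_perm a) = arc_word a.
Proof.
move=> /perm_arc_word pa; rewrite /arc_perm; case: pickP => [s /eqP//|/= none].
have sz : size (arc_word a) = n by rewrite (perm_size pa) size_enum_ord.
have ua : uniq (arc_word a) by rewrite (perm_uniq pa) enum_uniq.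
pose f (p : 'I_n) := nth p (arc_word a) p.
have f_inj : injective f.
  move=> p q; rewrite /f (set_nth_default q) ?sz // => /eqP.
  by rewrite nth_uniq ?sz // => /eqP/val_inj.
have /eqP[] := none (perm f_inj).
case: n => [|n] in a pa none sz ua f f_inj *.
  by rewrite (size0nil sz); apply: size0nil; rewrite size_map size_enum_ord.
apply: (@eq_from_nth _ ord0); first by rewrite size_map size_enum_ord sz.
rewrite size_map size_enum_ord => p pn.
rewrite (nth_map ord0) ?size_enum_ord // permE /f.
have -> : nth ord0 (enum 'I_n.+1) p = Ordinal pn.
  by apply: val_inj; rewrite /= nth_enum_ord.
by apply: set_nth_default; rewrite sz.
Qed.

Section Posets.
Variable n : nat.
Implicit Types (P T : rel 'I_n) (s : 'S_n) (E : rel 'S_n).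

Definition is_poset P : Prop := [/\ reflexive P, antisymmetric P & transitive P].

Definition is_linear_extension P s : Prop :=
  forall i j, P i j -> (s^-1%g i <= s^-1%g j)%N.

Definition congruence_poset E P : Prop :=
  is_poset P /\ exists s, forall t, E s t <-> is_linear_extension P t.

Definition hasse P : rel 'I_n := fun i j =>
  [&& i != j, P i j & [forall k, P i k && P k j ==> (k == i) || (k == j)]].

End Posets.

Section Trees.
Variable n : nat.
Implicit Types (T : rel 'I_n) (i j k : 'I_n) (L R : {set 'I_n}).

(** A directed graph on 'I_n is a relation, [T i j] being the edge i -> j. *)
Definition undirected T : rel 'I_n := fun i j => T i j || T j i.

Definition is_tree (g : rel 'I_n) : Prop :=
  [/\ 0 < n, irreflexive g, symmetric g, forall i j, connect g i j
    & forall c : seq 'I_n, ucycle g c -> size c < 3].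

Definition directed_tree T : Prop :=
  (forall i j, T i j -> ~~ T j i) /\ is_tree (undirected T).

Definition parents T j : {set 'I_n} := [set k | T j k].
Definition children T j : {set 'I_n} := [set k | T k j].

(** The connected component of T \ j containing k, for k != j. *)
Definition component T j k : {set 'I_n} :=
  [set x | connect [rel u v | [&& undirected T u v, u != j & v != j]] k x].

Definition ancestor_subtrees T j : {set {set 'I_n}} :=
  [set component T j k | k in parents T j].
Definition descendant_subtrees T j : {set {set 'I_n}} :=
  [set component T j k | k in children T j].

Definition set_lt L R : bool := [forall x in L, forall y in R, x < y].

Definition separates j L R : bool := set_lt L [set j] && set_lt [set j] R.

Definition separating_tree T : Prop :=
  directed_tree T /\
  forall j,
    [/\ #|parents T j| <= 2, #|children T j| <= 2,
        forall p q, p \in parents T j -> q \in parents T j -> p != q ->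
          separates j (component T j p) (component T j q)
          || separates j (component T j q) (component T j p)
      & forall p q, p \in children T j -> q \in children T j -> p != q ->
          separates j (component T j p) (component T j q)
          || separates j (component T j q) (component T j p)].

Definition mandatory_arc T (a : quadruple n) : Prop :=
  exists i k,
    [/\ i < k, undirected T i k
      & a = (i, k,
             [set j in open_itv i k | connect T j i || connect T j k],
             [set j in open_itv i k | connect T i j || connect T k j])].

Definition is_set_max L x : Prop := x \in L /\ forall y, y \in L -> y <= x.
Definition is_set_min R x : Prop := x \in R /\ forall y, y \in R -> x <= y.

Definition forbidden_up_arc T (a : quadruple n) : Prop :=
  exists j L R l r,
    [/\ L \in ancestor_subtrees T j /\ R \in ancestor_subtrees T j,
        set_lt L R, is_set_max L l, is_set_min R r & a = up_arc l r].

Definition forbidden_down_arc T (a : quadruple n) : Prop :=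
  exists j L R l r,
    [/\ L \in descendant_subtrees T j /\ R \in descendant_subtrees T j,
        set_lt L R, is_set_max L l, is_set_min R r & a = down_arc l r].

Definition admissible (E : rel 'S_n) T : Prop :=
  [/\ forall a, mandatory_arc T a -> a \in arcs_of E,
      forall a, forbidden_up_arc T a -> a \notin arcs_of E
    & forall a, forbidden_down_arc T a -> a \notin arcs_of E].

End Trees.

(* Main.v *)
Require Import Defs.
From HB Require Import structures.
From mathcomp Require Import all_boot all_fingroup.
From mathcomp Require Import zify.

Set Implicit Arguments.
Unset Strict Implicit.
Unset Printing Implicit Defensive.

(** An edge of the weak order swaps two consecutive entries [i < k] of a
    permutation. Whether a congruence contracts it depends only on the arc
    from [i] to [k] whose left points are the values standing before the two
    entries: the edge is perspective to the edge below the permutation of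
    this arc ([cong_swap]). Call the arcs of the congruence kept and the other
    arcs removed; the hexagons of the weak order show that subarcs of kept
    arcs are kept ([kept_sub]). In a class that is the set of linear
    extensions of a poset, two consecutive entries of a linear extension are
    therefore comparable exactly when their arc is kept ([kept_comparable]).

    From a class to a tree. Let [P] be the poset of a class. If [p < q] both
    cover [j], then [p] and [q] can be made consecutive just after [j]; their
    arc is removed whereas those of [j, p] and [j, q] are kept, so [j] lies
    between [p] and [q] ([fork_parents]). Simplicity provides inside this
    removed arc a minimal one, which is an up or down arc; it must pass [j] on
    the left, so it is an up arc, and by minimality all the points that it
    passes are below [j] ([fork_up_arc]). An edge of the Hasse diagram
    crossing [j] has a kept arc, which cannot contain this up arc; this forces
    an end of the edge to be below [j] ([fork_crossing]). Everything follows
    from this remark. A cycle of the Hasse diagram has a minimal point [j],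
    its neighbours on the cycle are two parents of [j], and the rest of the
    cycle crosses [j] without going below it: there is no cycle
    ([hasse_acyclic]). For the same reason no ancestor subtree of [j] has
    points on both sides of [j] ([separates_ancestors]), and the up arc of [j]
    is a subarc of its forbidden up arc ([removed_up_arc]). Since consecutive
    integers are comparable when the congruence is essential, the diagram is
    connected. Descendants are handled by reversing the poset
    ([class_poset_op]).

    From a tree to a class. Let [T] be an admissible separating tree. Two
    consecutive entries of a linear extension of [T] that are comparable form
    an edge, and their arc is the mandatory arc of this edge, which is kept
    ([consecutive_edge_kept]). If they are incomparable, say [i < k], the path
    from [i] to [k] makes a first turn, at some [j] comparable with [i]. All
    points between the two subtrees of [j] that contain [i] and [k] are
    comparable with [j] in the same direction ([between_descendants]), so the
    forbidden arc of [j] is a subarc of the arc of [i] and [k], which is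
    removed ([consecutive_incomparable_removed]). Hence a swap stays in the
    class exactly when it stays among the linear extensions; as both sets are
    connected by swaps, they coincide. *)

(** * Permutations as linear orders, and the lattice structure of the weak order *)

Section Before.
Variable n : nat.
Implicit Types (s t : 'S_n) (x y z : 'I_n).

Definition bef s x y : bool := (s^-1%g x < s^-1%g y)%N.

Lemma bef_irr s x : bef s x x = false.
Proof. by rewrite /bef ltnn. Qed.

Lemma bef_trans s : transitive (bef s).
Proof. by move=> y x z; apply: ltn_trans. Qed.

Lemma bef_total s x y : x != y -> bef s x y || bef s y x.
Proof.
move=> xy; rewrite /bef -neq_ltn; apply: contra xy => /eqP/val_inj/perm_inj->.
by [].
Qed.

Lemma bef_asym s x y : x != y -> bef s y x = ~~ bef s x y.
Proof.
move=> /(bef_total s) /orP[] h; rewrite h /bef; move: h; rewrite /bef; lia.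
Qed.

Lemma mem_inv_set s x y : ((x, y) \in inv_set s) = (y < x) && bef s x y.
Proof.
apply/imsetP/andP => [[[p q]] /=|[yx sxy]].
  by rewrite inE /= => /andP[pq qp] [-> ->]; rewrite /bef !permK.
by exists (s^-1%g x, s^-1%g y); rewrite ?inE /= !permKV // yx andbT.
Qed.

Lemma weak_leP s t :
  reflect (forall x y, y < x -> bef s x y -> bef t x y) (weak_le s t).
Proof.
apply: (iffP subsetP) => [h x y yx sxy|h [x y]].
  by have := h (x, y); rewrite !mem_inv_set yx sxy => /(_ isT).
by rewrite !mem_inv_set => /andP[yx /(h _ _ yx)->]; rewrite yx.
Qed.

Lemma weak_le_refl s : weak_le s s.
Proof. exact: subxx. Qed.

Lemma weak_le_trans s t u : weak_le s t -> weak_le t u -> weak_le s u.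
Proof. exact: subset_trans. Qed.

(** Contraposing an inclusion of inversion sets. *)
Lemma weak_le_noninv s t x y :
  weak_le s t -> x < y -> bef t x y -> bef s x y.
Proof.
move=> /weak_leP st xy txy.
have nxy : y != x by rewrite -(inj_eq val_inj) gtn_eqF.
by rewrite (bef_asym s nxy); apply: contraTN txy => /(st _ _ xy) h;
  rewrite (bef_asym t nxy) h.
Qed.

(** The position of [x] is the number of entries before it. *)
Lemma bef_inj s t : bef s =2 bef t -> s = t.
Proof.
have rank u x : #|[set z | bef u z x]| = u^-1%g x.
  have -> : [set z | bef u z x] = [set u p | p : 'I_n & p < u^-1%g x].
    apply/setP => z; rewrite inE; apply/idP/imsetP => [h|[p]].
      by exists (u^-1%g z); rewrite ?inE // permKV.
    by rewrite inE /bef => h ->; rewrite permK.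
  rewrite card_imset; last exact: perm_inj.
  have := ltn_ord (u^-1%g x); move: (nat_of_ord _) => k kn.
  have winj : injective (widen_ord (ltnW kn)).
    by move=> a b /(congr1 val) /= /val_inj.
  rewrite -[RHS](card_ord k) -(card_imset _ winj).
  apply: eq_card => z; rewrite inE; apply/idP/imsetP => [zk|[p _ ->]].
    by exists (Ordinal zk) => //; apply: val_inj.
  by case: p.
move=> st; apply: invg_inj; apply/permP => x; apply: val_inj => /=.
by rewrite -!rank; apply: eq_card => z; rewrite !inE st.
Qed.

(** A strict total order is realised by the permutation listing [x] at the
    position counting its predecessors. *)
Lemma perm_of_order (R : rel 'I_n) :
  irreflexive R -> transitive R -> (forall x y, x != y -> R x y || R y x) ->
  exists s, bef s =2 R.
Proof.
move=> irR trR totR.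
have rlt x : #|[set z | R z x]| < n.
  rewrite -[X in _ < X]card_ord -cardsT; apply: proper_card.
  rewrite properEneq subsetT andbT; apply/eqP => /setP/(_ x).
  by rewrite !inE irR.
pose r x := Ordinal (rlt x).
have rmono x y : R x y -> r x < r y.
  move=> xy /=; apply: proper_card; apply/properP; split.
    by apply/subsetP => z; rewrite !inE => zx; apply: trR xy.
  by exists x; rewrite !inE ?irR.
have rinj : injective r.
  move=> x y rxy; apply/eqP; apply: contraT => /totR /orP[] /rmono;
  by rewrite rxy ltnn.
exists (perm rinj)^-1%g => x y; rewrite /bef invgK !permE.
apply/idP/idP => [h|/rmono//].
have nxy : x != y by apply: contraTneq h => ->; rewrite ltnn.
by have /orP[//|/rmono] := totR _ _ nxy; move: h; lia.
Qed.

Lemma perm_of_key (k : 'I_n -> nat) :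
  exists s, forall x y, bef s x y = (k x < k y) || (k x == k y) && (x < y).
Proof.
apply: perm_of_order => [x|y x z|x y].
- by rewrite !ltnn andbF.
- lia.
- rewrite -(inj_eq val_inj) /=; lia.
Qed.

End Before.

Section Lattice.
Variable n : nat.
Variable k : 'I_n -> nat.
Hypothesis k_inj : injective k.
Implicit Types (s t u : 'S_n) (x y z : 'I_n).

(** The order of the values is given by an injective key [k], so that
    [k := val] and its reversal treat joins and meets at once. A set [J] of
    inversions that is transitive and splits at intermediate values is the
    inversion set of a permutation: inverting the pairs of [J] in the order of
    the values leaves it transitive. *)
Lemma perm_of_biclosed (J : rel 'I_n) :
    (forall x y, J x y -> k y < k x) -> transitive J ->
    (forall x y z, k z < k y -> k y < k x -> J x z -> J x y || J y z) ->
  exists s, forall x y, k y < k x -> bef s x y = J x y.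
Proof.
move=> Jlt Jtr Jco.
have [|y x z|x y|s sE] :=
    @perm_of_order n (fun x y => J x y || (k x < k y) && ~~ J y x).
- by move=> x; rewrite ltnn orbF; apply/negP => /Jlt; rewrite ltnn.
- have := Jlt x y; have := Jlt y z; have := Jlt x z; have := Jlt z x.
  have := Jtr y x z; have := Jtr x z y; have := Jtr z y x.
  have := Jco x z y; have := Jco y x z; have := Jco z y x.
  have [->|xz] := eqVneq x z.
    by case: (J z y) => //; case: (J y z) => //; lia.
  have : k x != k z by rewrite (inj_eq k_inj).
  case: (J x y); case: (J y z); case: (J x z); case: (J z x);
  case: (J z y); case: (J y x) => //=; lia.
- move=> xy; have : k x != k y by rewrite (inj_eq k_inj).
  have := Jlt x y; have := Jlt y x.
  case: (J x y) => //; case: (J y x) => //; lia.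
by exists s => x y yx; rewrite sE; case: (J x y) => //=; move: yx; lia.
Qed.

(** The inversions of the least upper bound are the transitive closure of the
    union of the two inversion sets: it is closed under refining a step
    because a step that jumps over [y] is an inversion of [s] or of [t], hence
    splits at [y] there. *)
Lemma upper_bound s t :
  exists u, [/\ forall x y, k y < k x -> bef s x y -> bef u x y,
                forall x y, k y < k x -> bef t x y -> bef u x y
    & forall v, (forall x y, k y < k x -> bef s x y -> bef v x y) ->
                (forall x y, k y < k x -> bef t x y -> bef v x y) ->
                forall x y, k y < k x -> bef u x y -> bef v x y].
Proof.
pose U : rel 'I_n := fun x y => (k y < k x) && (bef s x y || bef t x y).
have Ule x y : connect U x y -> k y <= k x.
  case/connectP => p; elim: p x => [|z p IH] x /=; first by move=> _ ->.
  by move=> /andP[/andP[zx _] /IH h] /h; lia.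
pose J : rel 'I_n := fun x y => (x != y) && connect U x y.
have Jlt x y : J x y -> k y < k x.
  by case/andP => xy /Ule; rewrite leq_eqVlt (inj_eq k_inj) eq_sym (negbTE xy).
have Jco x y z : k z < k y -> k y < k x -> J x z -> J x y || J y z.
  move=> zy yx /andP[_ /connectP[p]].
  have nyz : y != z by apply: contraTneq zy => ->; rewrite ltnn.
  have nxy : x != y by apply: contraTneq yx => ->; rewrite ltnn.
  rewrite /J nyz nxy /=.
  elim: p x yx {nxy} => [|w p IH] x yx /=; first by move=> _ zE; move: zy yx; rewrite zE; lia.
  move=> /andP[xw pw] zE.
  have [wy|yw] := ltnP (k w) (k y); last first.
    have [<-|nwy] := eqVneq w y; first by rewrite connect1.
    have {}yw : k y < k w by rewrite ltn_neqAle eq_sym (inj_eq k_inj) nwy.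
    by case/orP: (IH w yw pw zE) => [h|->]; rewrite ?orbT // (connect_trans (connect1 xw)).
  have wz : connect U w z by apply/connectP; exists p.
  case/andP: xw => _ xw.
  have nyx : x != y by apply: contraTneq yx => ->; rewrite ltnn.
  suff : U x y || U y w.
    case/orP => [/connect1->//|/connect1 h].
    by rewrite (connect_trans h wz) orbT.
  rewrite /U yx wy /=.
  case/orP: xw => xw.
    have /orP[->//|h] := bef_total s nyx.
    by rewrite (bef_trans h xw) !orbT.
  have /orP[->|h] := bef_total t nyx; first by rewrite orbT.
  by rewrite (bef_trans h xw) !orbT.
have Jtr : transitive J.
  move=> y x z xy yz; have := Jlt _ _ xy; have := Jlt _ _ yz.
  case/andP: xy => _ xy; case/andP: yz => _ yz zy yx.
  rewrite /J (connect_trans xy yz) andbT.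
  by apply: contraTneq (ltn_trans zy yx) => ->; rewrite ltnn.
have [u uE] := perm_of_biclosed Jlt Jtr Jco.
have UJ x y : k y < k x -> bef s x y || bef t x y -> bef u x y.
  move=> yx h; rewrite uE // /J connect1 ?andbT /U ?yx //.
  by apply: contraTneq yx => ->; rewrite ltnn.
exists u; split=> [x y yx h|x y yx h|v sv tv x y yx].
- by rewrite UJ // h.
- by rewrite UJ // h orbT.
rewrite uE // => /andP[xy /connectP[p]].
elim: p x xy {yx} => [|z p IH] x xy /=; first by move=> _ yE; rewrite yE eqxx in xy.
move=> /andP[/andP[zx xz] pz] yE.
have {}xz : bef v x z by case/orP: xz => [/sv|/tv]; apply.
have [zy|zy] := eqVneq z y; first by rewrite -zy.
exact: bef_trans xz (IH _ zy pz yE).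
Qed.

End Lattice.

Section WeakLattice.
Variable n : nat.
Implicit Types (s t u v : 'S_n) (x y z : 'I_n).

Lemma join_exists s t : exists u, is_join s t u.
Proof.
have [u [su tu uv]] := @upper_bound n val val_inj s t.
exists u; split; [exact/weak_leP|exact/weak_leP|move=> v /weak_leP sv /weak_leP tv].
by apply/weak_leP; apply: uv.
Qed.

(** Reversing the order of the values exchanges inversions and
    non-inversions. *)
Lemma meet_exists s t : exists u, is_meet s t u.
Proof.
have kinj : injective (fun x : 'I_n => n - x).
  by move=> x y h; apply: val_inj => /=; have := ltn_ord x; have := ltn_ord y; lia.
have [u [su tu uv]] := @upper_bound n _ kinj s t.
have klt x y : (n - y < n - x) = (x < y).
  by have := ltn_ord x; have := ltn_ord y; lia.
have conv a b : (forall x y, n - y < n - x -> bef a x y -> bef b x y) <-> weak_le b a.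
  split=> [h|h x y]; last by rewrite klt => xy; apply: weak_le_noninv h xy.
  apply/weak_leP => x y yx; have nxy : y != x by rewrite -(inj_eq val_inj) ltn_eqF.
  rewrite (bef_asym b nxy) (bef_asym a nxy); apply: contra => h'.
  by apply: h h'; rewrite klt.
exists u; split; [exact/conv|exact/conv|move=> v /conv sv /conv tv].
by apply/conv; apply: uv.
Qed.

End WeakLattice.

(** * Swaps of consecutive entries and the permutation of an arc *)

Section Swap.
Variable n : nat.
Implicit Types (s t : 'S_n) (x y z : 'I_n).

(** Asking only that a single pair changes its relative order forces [x] and
    [y] to be consecutive. *)
Definition swap s t x y : Prop :=
  [/\ bef s x y, bef t y x
    & forall u v, (u, v) != (x, y) -> (u, v) != (y, x) -> bef t u v = bef s u v].

Lemma swap_neq s t x y : swap s t x y -> x != y.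
Proof. by case=> h _ _; apply: contraTneq h => ->; rewrite bef_irr. Qed.

Lemma swap_sym s t x y : swap s t x y -> swap t s y x.
Proof. by case=> h1 h2 h3; split=> // u v uv vu; rewrite h3. Qed.

(** A point between [x] and [y] in [s] would make [t] cyclic. *)
Lemma swap_gap s t x y z :
  swap s t x y -> z != x -> z != y -> bef s z x = bef s z y.
Proof.
move=> sw zx zy; have xy := swap_neq sw; case: sw => sxy tyx h.
apply/idP/idP => [zx'|zy']; first exact: bef_trans zx' sxy.
have nxz : x != z by rewrite eq_sym.
rewrite (bef_asym s nxz); apply/negP => xz'.
have txz : bef t x z by rewrite h // xpair_eqE ?eqxx ?(negbTE zy) ?(negbTE zx) ?andbF ?(negbTE xy).
have tzy : bef t z y by rewrite h // xpair_eqE ?(negbTE zx) ?(negbTE zy).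
by have := bef_trans (bef_trans txz tzy) tyx; rewrite bef_irr.
Qed.

Lemma swap_exists s x y :
    bef s x y -> (forall z, bef s x z -> bef s z y -> False) ->
  exists t, swap s t x y.
Proof.
move=> sxy gap.
have xy : x != y by apply: contraTneq sxy => ->; rewrite bef_irr.
have E u v : bef (s * tperm x y)%g u v = bef s (tperm x y u) (tperm x y v).
  by rewrite /bef invMg tpermV !permM.
have gapl z : z != x -> z != y -> bef s z x = bef s z y.
  move=> zx zy; apply/idP/idP => h; first exact: bef_trans h sxy.
  by have /orP[//|h'] := bef_total s zx; case: (gap z h' h).
have gapr z : z != x -> z != y -> bef s x z = bef s y z.
  by move=> zx zy; rewrite (bef_asym s zx) (bef_asym s zy) gapl.
exists (s * tperm x y)%g; split; first by [].
  by rewrite E tpermL tpermR.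
move=> u v; rewrite !xpair_eqE E.
case: (tpermP x y u) => [->|->|/eqP ux /eqP uy];
case: (tpermP x y v) => [->|->|/eqP vx /eqP vy];
rewrite ?eqxx ?bef_irr //= => _ _.
- by rewrite gapr.
- by rewrite gapr.
- by rewrite gapl.
- by rewrite gapl.
Qed.

Lemma swap_weak_le s t x y : swap s t x y -> x < y -> weak_le s t.
Proof.
case=> sxy tyx h xy; apply/weak_leP => u v vu suv.
have [[uE vE]|n1] := eqVneq (u, v) (x, y); first by move: vu xy; rewrite uE vE; lia.
have [[-> ->]//|n2] := eqVneq (u, v) (y, x).
by rewrite h.
Qed.

End Swap.

Section SplitArc.
Variable n : nat.
Implicit Types (s t : 'S_n) (x y z i j u v : 'I_n) (D : {set 'I_n}).

(** Encoding both sides of an arc by one set [D] of left points makes its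
    subarcs the subintervals of ]i, j[ with the same [D]. *)
Definition split_arc i j D : quadruple n :=
  (i, j, open_itv i j :&: D, open_itv i j :\: D).

Lemma is_arc_split i j D : i < j -> is_arc (split_arc i j D).
Proof.
move=> ij; rewrite /= ij setID eqxx /=; apply/pred0P => x /=; rewrite !inE.
by case: (x \in D); rewrite ?andbF.
Qed.

Lemma pairwise_bef s (r : rel 'I_n) x y :
  pairwise r (one_line s) -> bef s x y -> r x y.
Proof.
move=> /(pairwiseP x) pr xy.
have nthE z : nth x (one_line s) (s^-1%g z) = z.
  by rewrite (nth_map x) ?size_enum_ord // nth_ord_enum permKV.
have := pr (s^-1%g x) (s^-1%g y); rewrite !nthE !inE /one_line size_map size_enum_ord.
by apply.
Qed.

Lemma enum_pairwise (A : pred 'I_n) (r : rel 'I_n) :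
    (forall x y, A x -> A y -> x < y -> r x y) ->
  pairwise r [seq x <- enum 'I_n | A x].
Proof.
move=> Ar; apply: (@sub_in_pairwise _ A (fun x y : 'I_n => x < y)).
- by move=> x y; apply: Ar.
- exact: filter_all.
apply: pairwise_filter.
have : pairwise ltn (map val (enum 'I_n)).
  rewrite val_enum_ord -sorted_pairwise; [exact: iota_ltn_sorted|exact: ltn_trans].
by rewrite pairwise_map.
Qed.

Lemma ord_eqE x y : (x == y) = (x == y :> nat).
Proof. by rewrite -(inj_eq val_inj). Qed.

(* With both memberships decided, only linear arithmetic is left. *)
Ltac by_membership D a b := rewrite ?ord_eqE;
  case: (a \in D); case: (b \in D); rewrite ?orbT ?orbF ?andbT ?andbF /=; lia.

(** The inversions of [arc_perm] go from [j] and the left points to [i] and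
    the right points. The word is checked blockwise against the order [r]
    having these inversions. *)
Lemma bef_arc_perm i j D u v : i < j -> v < u ->
  bef (arc_perm (split_arc i j D)) u v =
  [&& i <= v, u <= j, (u == j) || (u \in D) & (v == i) || (v \notin D)].
Proof.
move=> ij vu; set m := arc_perm _.
pose c (u v : 'I_n) :=
  [&& i <= v, u <= j, (u == j) || (u \in D) & (v == i) || (v \notin D)].
pose r : rel 'I_n := fun x y => (y < x) && c x y || (x < y) && ~~ c y x.
have pm x y : bef m x y -> r x y.
  apply: pairwise_bef; rewrite (one_line_arc_perm (is_arc_split D ij)) /arc_word /split_arc.
  have enumE (A : {set 'I_n}) : enum A = [seq x <- enum 'I_n | x \in A].
    by rewrite {1}/enum_mem enumT.
  rewrite !(enumE (_ :&: _)) !(enumE (_ :\: _)) !pairwise_cat !allrel_catr /=.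
  rewrite !enum_pairwise ?andbT /=; last first.
  - by move=> a b; rewrite /r /c; by_membership D a b.
  - by move=> a b; rewrite !inE; rewrite /r /c; by_membership D a b.
  - by move=> a b; rewrite !inE; rewrite /r /c; by_membership D a b.
  - by move=> a b; rewrite /r /c; by_membership D a b.
  have arl (P Q : pred 'I_n) : (forall a b, P a -> Q b -> r a b) ->
     allrel r [seq x <- enum 'I_n | P x] [seq x <- enum 'I_n | Q x].
    move=> PQ; apply/allrelP => a b; rewrite !mem_filter => /andP[Pa _] /andP[Qb _].
    exact: PQ.
  have arr (P : pred 'I_n) a b : (forall d, P d -> r d a && r d b) ->
     allrel r [seq x <- enum 'I_n | P x] [:: a; b].
    move=> PQ; apply/allrelP => d e; rewrite !mem_filter !inE => /andP[Pa _].
    by case/andP: (PQ _ Pa) => ? ? /orP[]/eqP->.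
  have arll (P : pred 'I_n) a b : (forall d, P d -> r a d && r b d) ->
     allrel r [:: a; b] [seq x <- enum 'I_n | P x].
    move=> PQ; apply/allrelP => d e; rewrite !mem_filter !inE => de /andP[Pa _].
    by case/andP: (PQ _ Pa) => ? ?; case/orP: de => /eqP->.
  repeat (apply/andP; split).
  all: try (apply: arl => a b); try (apply: arr => a); try (apply: arll => a).
  all: try (apply/allP => a; rewrite mem_filter => /andP[+ _]).
  all: rewrite ?inE //.
  all: rewrite /r /c.
  all: try first [by by_membership D a b | by by_membership D a a | by by_membership D i j].
  by have [->|] := eqVneq a b; [case: (b \in D); rewrite ?andbF|by_membership D a b].
have nuv : u != v by apply: contraTneq vu => ->; rewrite ltnn.
apply/idP/idP => [/pm|cuv]; first by rewrite /r vu (ltnNge u) ltnW //= orbF.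
have /orP[//|/pm] := bef_total m nuv.
by rewrite /r vu (ltnNge u) (ltnW vu) /= /c cuv.
Qed.
End SplitArc.

(** * Contracted edges of the weak order and arcs of a congruence *)

Section Congruence.
Variables (n : nat) (E : rel 'S_n).
Hypothesis hE : lattice_congruence E.
Implicit Types (s t : 'S_n) (x y z i j u v : 'I_n) (D : {set 'I_n}).

Lemma is_join_le s t : weak_le s t -> is_join s t t.
Proof. by split=> //; apply: weak_le_refl. Qed.

Lemma is_meet_le s t : weak_le s t -> is_meet s t s.
Proof. by split=> //; apply: weak_le_refl. Qed.

Lemma is_joinC s t m : is_join s t m -> is_join t s m.
Proof. by case=> sm tm h; split=> // x tx sx; apply: h. Qed.

Lemma is_meetC s t m : is_meet s t m -> is_meet t s m.
Proof. by case=> sm tm h; split=> // x tx sx; apply: h. Qed.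

Lemma cong_refl s : E s s.
Proof. by case: hE => eqE _ _; case: (eqE s s s). Qed.

Lemma cong_sym s t : E s t = E t s.
Proof.
case: hE => eqE _ _; apply/idP/idP => st.
  by rewrite -((eqE _ _ s).2 st) cong_refl.
by rewrite -((eqE _ _ t).2 st) cong_refl.
Qed.

Lemma cong_trans t s r : E s t -> E t r -> E s r.
Proof. by case: hE => eqE _ _ st tr; rewrite ((eqE _ _ r).2 st). Qed.

Lemma cong_join s s' t m m' :
  E s s' -> is_join s t m -> is_join s' t m' -> E m m'.
Proof. by case: hE => _ _ h ss' jm jm'; apply: h jm jm' => //; apply: cong_refl. Qed.

Lemma cong_meet s s' t m m' :
  E s s' -> is_meet s t m -> is_meet s' t m' -> E m m'.
Proof. by case: hE => _ h _ ss' jm jm'; apply: h jm jm' => //; apply: cong_refl. Qed.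

(** Joining [s] and [r] with the intermediate [t] gives [t] and [r]. *)
Lemma cong_convex s t r : weak_le s t -> weak_le t r -> E s r -> E s t.
Proof.
move=> st tr sr; apply: (cong_trans sr); rewrite cong_sym.
exact: cong_join sr (is_join_le st) (is_joinC (is_join_le tr)).
Qed.

(** The arcs of the congruence; the other arcs are called removed. *)
Definition kept i j D : bool := split_arc i j D \in arcs_of E.

Lemma kept_ext i j D D' :
  (forall z, i < z < j -> (z \in D) = (z \in D')) -> kept i j D = kept i j D'.
Proof.
move=> DD'; rewrite /kept /split_arc.
have -> : open_itv i j :&: D = open_itv i j :&: D'.
  by apply/setP => z; have := DD' z; rewrite !inE; case: (i < z < j) => //= ->.
have -> // : open_itv i j :\: D = open_itv i j :\: D'.
apply/setP => z; have := DD' z.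
by rewrite !inE; case: (i < z < j); rewrite ?andbF // => ->.
Qed.

(** The edge [s -- t] of the weak order is perspective to the edge below the
    join-irreducible [m := arc_perm (split_arc x y D)]: joining the latter
    with [s] gives the former, and meeting the former with [m] gives the
    latter. So the congruence contracts both or neither, and it contracts the
    edge below [m] exactly when [m] is not minimal in its class. *)
Lemma cong_swap s t x y D : swap s t x y -> x < y ->
    (forall z, z != x -> z != y -> (z \in D) = bef s z x) ->
  E s t = ~~ kept x y D.
Proof.
move=> sw xy DE; have [sxy tyx swE] := sw; have nxy := swap_neq sw.
set m := arc_perm (split_arc x y D).
have mE u v := bef_arc_perm D xy (u := u) (v := v); rewrite -/m in mE.
have ltn_neq (a b : 'I_n) : a < b -> (a == b) = false /\ (b == a) = false.
  by move=> ab; split; apply/negbTE; apply: contraTneq ab => ->; rewrite ltnn.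
have myx : bef m y x by rewrite mE // !leqnn !eqxx.
have [m' sw'] : exists m', swap m m' y x.
  apply: swap_exists => // z myz mzx.
  case: (ltngtP x z) => [xz|zx|/val_inj zE]; last by rewrite -zE bef_irr in mzx.
    rewrite mE // in mzx.
    case/and4P: mzx => _ zy zD _.
    have [zE|nzy] := eqVneq z y; first by rewrite zE bef_irr in myz.
    have zy' : z < y by rewrite ltn_neqAle zy andbT.
    rewrite mE // (proj2 (ltn_neq _ _ xz)) /= in myz.
    case/and4P: myz => _ _ _; case/orP: zD => [/eqP zE|->//].
    by rewrite zE eqxx in nzy.
  rewrite mE ?(ltn_trans zx xy) // in myz.
  by case/and4P: myz; rewrite leqNgt zx.
have [_ m'xy sw'E] := sw'.
have mt : weak_le m t.
  apply/weak_leP => u v vu; rewrite mE // => /and4P[xv uy uD vD].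
  have [uE|nuy] := eqVneq u y.
    have [vE|nvx] := eqVneq v x; first by rewrite uE vE.
    rewrite uE swE ?xpair_eqE ?eqxx ?(negbTE nvx) ?andbF //; last first.
      by rewrite eq_sym (negbTE nxy).
    have nvy : v != y by apply: contraTneq vu => ->; rewrite uE ltnn.
    rewrite (bef_asym _ nvy) -(swap_gap sw) // -DE //.
    by move: vD; rewrite (negbTE nvx).
  have nux : u != x by apply: contraTneq vu => ->; rewrite -leqNgt.
  have sux : bef s u x by move: uD; rewrite (negbTE nuy) /= DE.
  rewrite swE ?xpair_eqE ?(negbTE nuy) ?(negbTE nux) //.
  have [vE|nvx] := eqVneq v x; first by rewrite vE.
  have nvy : v != y by apply: contraTneq vu => ->; rewrite -leqNgt.
  apply: bef_trans sux _; rewrite (bef_asym _ nvx) -DE //.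
  by move: vD; rewrite (negbTE nvx).
have joinms : is_join m s t.
  split=> //; first exact: swap_weak_le sw xy.
  move=> w /weak_leP mw /weak_leP sw_; apply/weak_leP => u v vu tuv.
  have [[-> ->]|n1] := eqVneq (u, v) (y, x); first exact: mw.
  apply: sw_ => //; rewrite -swE //.
  by apply: contraTneq vu => -[-> ->]; rewrite -leqNgt ltnW.
have m's : weak_le m' s.
  apply/weak_leP => u v vu m'uv.
  have n2 : (u, v) != (x, y) by apply: contraTneq vu => -[-> ->]; rewrite -leqNgt ltnW.
  have n1 : (u, v) != (y, x).
    by apply: contraTneq m'uv => -[-> ->]; rewrite (bef_asym _ nxy) m'xy.
  rewrite -swE //; apply: (weak_leP _ _ mt) => //.
  by rewrite -sw'E.
have m'm : weak_le m' m by apply: swap_weak_le (swap_sym sw') xy.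
have below w : weak_le w m -> bef w x y -> weak_le w m'.
  move=> /weak_leP wm wxy; apply/weak_leP => u v vu wuv.
  rewrite sw'E ?wm //.
    by apply: contraTneq wuv => -[-> ->]; rewrite (bef_asym _ nxy) wxy.
  by apply: contraTneq vu => -[-> ->]; rewrite -leqNgt ltnW.
have meetms : is_meet m s m'.
  split=> // w wm ws; apply: below => //.
  exact: weak_le_noninv ws xy sxy.
have -> : E s t = E m m'.
  apply/idP/idP => h.
    rewrite cong_sym; apply: (cong_meet h (is_meetC meetms)).
    exact: is_meetC (is_meet_le mt).
  by rewrite cong_sym; apply: (cong_join h joinms); apply: is_join_le.
rewrite /kept inE is_arc_split //= -/(split_arc x y D) -/m /is_class_min.
apply/idP/idP => [h|].
  apply/forallPn; exists m'; rewrite h /=; apply/weak_leP => /(_ _ _ xy myx).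
  by rewrite (bef_asym _ nxy) m'xy.
case/forallPn => r; rewrite negb_imply => /andP[mr nmr].
have [w wE] := meet_exists m r.
have Emw : E m w := cong_meet mr (is_meet_le (weak_le_refl m)) (is_meetC wE).
case: (wE) => wm wr _.
have wxy : bef w x y.
  have nyx : y != x by rewrite eq_sym.
  rewrite (bef_asym _ nyx); apply: contra nmr => wyx.
  apply: weak_le_trans wr; apply/weak_leP => u v vu muv.
  move: (muv); rewrite mE // => /and4P[xv uy uD vD].
  (* everything in the left block stays before [y], and in the right block
     after [x], below [m] *)
  have wuy : (u == y) || bef w u y.
    have [//|nuy] := eqVneq u y; rewrite /=.
    have uy' : u < y by rewrite ltn_neqAle nuy.
    apply: (weak_le_noninv wm uy'); rewrite (bef_asym m (x := y)) 1?eq_sym //.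
    rewrite mE //; move: uD; rewrite (negbTE nuy) /= => ->.
    by case: (eqVneq u x) => [uE|_]; rewrite ?andbF //;
      move: vu; rewrite uE ltnNge xv.
  have wxv : (v == x) || bef w x v.
    have [//|nvx] := eqVneq v x; rewrite /=.
    have xv' : x < v by rewrite ltn_neqAle eq_sym nvx.
    apply: (weak_le_noninv wm xv'); rewrite (bef_asym m (x := v)) //.
    rewrite mE //; move: vD; rewrite (negbTE nvx) /= => /negbTE->.
    by case: (eqVneq v y) => [vE|_]; rewrite ?andbF //;
      move: vu; rewrite vE ltnNge uy.
  have wux : bef w u x by case/orP: wuy => [/eqP->//|/bef_trans]; apply.
  by case/orP: wxv => [/eqP->//|]; apply: bef_trans.
have Ewm' : E w m' by apply: cong_convex (below _ wm wxy) m'm _; rewrite cong_sym.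
exact: cong_trans Emw Ewm'.
Qed.

Lemma cong_swap_down s t x y D : swap s t y x -> x < y ->
    (forall z, z != x -> z != y -> (z \in D) = bef s z y) ->
  E s t = ~~ kept x y D.
Proof.
move=> sw xy DE; rewrite cong_sym; apply: cong_swap (swap_sym sw) xy _.
move=> z zx zy; rewrite DE // (swap_gap (swap_sym sw)) //; case: sw => _ _ ->//;
  by rewrite xpair_eqE ?(negbTE zx) ?(negbTE zy).
Qed.

End Congruence.

(** * Forcing: the arcs of a congruence are closed under subarcs *)

Section Hexagon.
Variables (n : nat) (E : rel 'S_n).
Hypothesis hE : lattice_congruence E.
Variables (i j k : 'I_n) (D : {set 'I_n}).
Hypotheses (ij : i < j) (jk : j < k).
Implicit Types (s t : 'S_n) (x y z u v : 'I_n).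

Let T : seq 'I_n := [:: i; j; k].
Let ik : i < k := ltn_trans ij jk.
Let nij : i != j. Proof. by rewrite ord_eqE; lia. Qed.
Let njk : j != k. Proof. by rewrite ord_eqE; lia. Qed.
Let nik : i != k. Proof. by rewrite ord_eqE; lia. Qed.
Let nji : j != i. Proof. by rewrite ord_eqE; lia. Qed.
Let nkj : k != j. Proof. by rewrite ord_eqE; lia. Qed.
Let nki : k != i. Proof. by rewrite ord_eqE; lia. Qed.

(* Six permutations of a hexagon: the points of [D], then [i, j, k] in any
   order, then the other points; [word s a b c] records by booleans the
   relative order of [i, j, k] in [s]. *)
Let rank z := if z \in T then 1 else if z \in D then 0 else 2.

Let around s := forall u v, ~~ ((u \in T) && (v \in T)) ->
  bef s u v = (rank u < rank v) || (rank u == rank v) && (u < v).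

Let word s a b c := [/\ around s, bef s i j = a, bef s i k = b & bef s j k = c].

Let word_exists (a b c : nat) : a < 3 -> b < 3 -> c < 3 ->
  a != b -> a != c -> b != c -> exists s, word s (a < b) (a < c) (b < c).
Proof.
move=> a3 b3 c3 ab ac bc.
pose key z := if z == i then a.+1 else if z == j then b.+1 else
  if z == k then c.+1 else if z \in D then 0 else 4.
have [s sE] := perm_of_key key.
exists s; split; rewrite ?sE /key ?eqxx ?(negbTE nji) ?(negbTE nki) ?(negbTE nkj);
  try lia.
have keyT z : z \in T -> 0 < key z < 4.
  by rewrite /key !inE; case: eqP => //= _; case: eqP => //= _; case: eqP.
have keyN z : z \notin T -> key z = if z \in D then 0 else 4.
  by rewrite /key !inE; case: eqP => //= _; case: eqP => //= _; case: eqP.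
move=> u v; rewrite sE /rank; have := keyT u; have := keyT v.
have := keyN u; have := keyN v; move: (key u) (key v) => ku kv.
case: (u \in T) (v \in T) => [] [] //= kvN kuN.
- by rewrite kvN // => _ /(_ isT); case: (v \in D); lia.
- by rewrite kuN // => /(_ isT) + _; case: (u \in D); lia.
- by rewrite kvN // kuN //; case: (u \in D); case: (v \in D).
Qed.

Let word_bef s a b c : word s a b c ->
  (((bef s i j = a) * (bef s i k = b) * (bef s j k = c)) *
   ((bef s j i = ~~ a) * (bef s k i = ~~ b) * (bef s k j = ~~ c)) *
   ((bef s i i = false) * (bef s j j = false) * (bef s k k = false)))%type.
Proof.
case=> _ h1 h2 h3; rewrite !bef_irr h1 h2 h3.
by rewrite (bef_asym s nij) (bef_asym s nik) (bef_asym s njk) h1 h2 h3.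
Qed.

Let nT : ((i == j) = false) * ((j == i) = false) * ((i == k) = false) *
  ((k == i) = false) * ((j == k) = false) * ((k == j) = false).
Proof. by rewrite !(negbTE nij, negbTE nji, negbTE nik, negbTE nki, negbTE njk, negbTE nkj). Qed.

(* The booleans are added as integers: at most one pair changes its order. *)
Let word_swap s t a b c a' b' c' x y : word s a b c -> word t a' b' c' ->
  x \in T -> y \in T -> bef s x y -> bef t y x ->
  (a != a') + (b != b') + (c != c') <= 1 ->
  swap s t x y.
Proof.
move=> ws wt xT yT sxy tyx.
have := word_bef wt; have := word_bef ws; case: ws wt => [as_ _ _ _] [at_ _ _ _] sE tE d.
split=> // u v; case uvT : ((u \in T) && (v \in T)); last by rewrite as_ ?at_ ?uvT.
move: uvT sxy tyx d; move: xT yT; rewrite !inE.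
case/or3P=> /eqP-> /or3P[] /eqP-> /andP[/or3P[] /eqP-> /or3P[] /eqP->];
  rewrite ?sE ?tE ?xpair_eqE ?nT ?eqxx //=;
  by case: a a' b b' c c' {sE tE} => [] [] [] [] [] [].
Qed.

Let word_le s t a b c a' b' c' : word s a b c -> word t a' b' c' ->
  (a' ==> a) && (b' ==> b) && (c' ==> c) -> weak_le s t.
Proof.
move=> ws wt.
have := word_bef wt; have := word_bef ws; case: ws wt => [as_ _ _ _] [at_ _ _ _] sE tE.
move=> /andP[/andP[/implyP da /implyP db] /implyP dc].
apply/weak_leP => u v vu.
case uvT : ((u \in T) && (v \in T)); last by rewrite as_ ?at_ ?uvT.
move: uvT vu; rewrite !inE => /andP[/or3P[]/eqP-> /or3P[]/eqP->] vu;
  rewrite ?sE ?tE; first [exact: contra|by move: vu; clear -ij jk; lia].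
Qed.

(* An upper bound inverting [i, j] and [j, k] also inverts [i, k], so it is
   above the top of the hexagon. *)
Let word_join s t r a b c a' b' c' : word s a b c -> word t a' b' c' ->
  word r false false false -> ~~ a || ~~ a' -> ~~ c || ~~ c' -> is_join s t r.
Proof.
move=> ws wt wr da dc.
have [sr tr] : weak_le s r /\ weak_le t r.
  by split; [apply: word_le ws wr _|apply: word_le wt wr _].
split=> // w /weak_leP sw /weak_leP tw; apply/weak_leP => u v vu.
have := word_bef wr; have := word_bef wt; have := word_bef ws.
case: ws wr => [as_ _ _ _] [ar _ _ _] sE tE rE.
case uvT : ((u \in T) && (v \in T)); last first.
  by rewrite ar ?uvT // => h; apply: sw => //; rewrite as_ ?uvT.
have wji : bef w j i by case/orP: da => h; [apply: sw|apply: tw]; rewrite ?sE ?tE.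
have wkj : bef w k j by case/orP: dc => h; [apply: sw|apply: tw]; rewrite ?sE ?tE.
have wki := bef_trans wkj wji.
by move: uvT vu; rewrite !inE => /andP[/or3P[]/eqP-> /or3P[]/eqP->] // vu; move: vu; clear -ij jk; lia.
Qed.

Let word_meet s t r a b c a' b' c' : word s a b c -> word t a' b' c' ->
  word r true true true -> a || a' -> c || c' -> is_meet s t r.
Proof.
move=> ws wt wr da dc.
have [sr tr] : weak_le r s /\ weak_le r t.
  by split; [apply: word_le wr ws _|apply: word_le wr wt _]; rewrite !implybT.
split=> // w ws_ wt_; apply/weak_leP => u v vu.
have := word_bef wr; have := word_bef wt; have := word_bef ws.
case: ws wr => [as_ _ _ _] [ar _ _ _] sE tE rE.
case uvT : ((u \in T) && (v \in T)); last first.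
  by move/(weak_leP _ _ ws_ _ _ vu); rewrite ar ?as_ ?uvT.
have wij : bef w i j.
  by case/orP: da => h; [apply: weak_le_noninv ws_ _ _|apply: weak_le_noninv wt_ _ _]; rewrite ?sE ?tE.
have wjk : bef w j k.
  by case/orP: dc => h; [apply: weak_le_noninv ws_ _ _|apply: weak_le_noninv wt_ _ _]; rewrite ?sE ?tE.
have wik := bef_trans wij wjk.
move: uvT vu; rewrite !inE => /andP[/or3P[]/eqP-> /or3P[]/eqP->] vu; try by move: vu; clear -ij jk; lia.
- by rewrite (bef_asym _ nij) wij.
- by rewrite (bef_asym _ nik) wik.
- by rewrite (bef_asym _ njk) wjk.
Qed.

Let word_cong s t a b c a' b' c' x y : word s a b c -> word t a' b' c' ->
  x \in T -> y \in T -> x < y -> bef s x y -> bef t y x ->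
  (a != a') + (b != b') + (c != c') <= 1 ->
  (x < j < y -> (j \in D) = bef s j x) -> E s t = ~~ kept E x y D.
Proof.
move=> ws wt xT yT xy sxy tyx d jD.
rewrite (cong_swap hE (D := [set z | bef s z x]) (word_swap ws wt xT yT sxy tyx d)) //.
  congr (~~ _); apply: kept_ext => z zxy; rewrite inE.
  have [zj|nzj] := eqVneq z j; first by rewrite zj -jD // -zj.
  have zT : z \notin T.
    rewrite !inE (negbTE nzj) !ord_eqE; move: zxy xT yT; rewrite !inE.
    by move=> zxy /or3P[]/eqP xE /or3P[]/eqP yE; move: zxy; rewrite xE yE; clear -ij jk; lia.
  case: ws => ar _ _ _; rewrite ar ?(negbTE zT) // /rank xT (negbTE zT).
  by case: (z \in D).
by move=> z zx zy; rewrite inE.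
Qed.

(** In the hexagon from ijk to kji, the edges ijk - jik and kij - kji have the
    same arc, from [i] to [j]. If they are contracted, joining with ikj and
    meeting with jki contracts both middle edges, jik - jki and ikj - kij,
    whose arcs go from [i] to [k] with [j] on the left and on the right. *)
Lemma kept_right : ~~ kept E i j D -> ~~ kept E i k D.
Proof.
move=> nk.
have [ijk wijk] := @word_exists 0 1 2 isT isT isT isT isT isT.
have [jik wjik] := @word_exists 1 0 2 isT isT isT isT isT isT.
have [jki wjki] := @word_exists 2 0 1 isT isT isT isT isT isT.
have [ikj wikj] := @word_exists 0 2 1 isT isT isT isT isT isT.
have [kij wkij] := @word_exists 1 2 0 isT isT isT isT isT isT.
have [kji wkji] := @word_exists 2 1 0 isT isT isT isT isT isT.
have iT : i \in T by rewrite !inE eqxx.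
have jT : j \in T by rewrite !inE eqxx orbT.
have kT : k \in T by rewrite !inE eqxx !orbT.
have E1 : E ijk jik.
  by rewrite (word_cong wijk wjik iT jT) ?(word_bef wijk) ?(word_bef wjik) // ltnn andbF.
have E2 : E kij kji.
  by rewrite (word_cong wkij wkji iT jT) ?(word_bef wkij) ?(word_bef wkji) // ltnn andbF.
have [jD|jD] := boolP (j \in D).
  have <- : E jik jki = ~~ kept E i k D.
    by rewrite (word_cong wjik wjki iT kT) ?(word_bef wjik) ?(word_bef wjki) ?jD.
  apply: cong_trans (hE) _ _ _ _ (_ : E ijk jki); first by rewrite cong_sym.
  apply: (cong_meet hE E2 (t := jki)); first exact: word_meet wkij wjki wijk _ _.
  by apply/is_meetC/is_meet_le; apply: word_le wjki wkji _.
have <- : E ikj kij = ~~ kept E i k D.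
  by rewrite (word_cong wikj wkij iT kT) ?(word_bef wikj) ?(word_bef wkij) ?(negbTE jD).
apply: cong_trans (hE) _ _ _ (_ : E ikj kji) _; last by rewrite cong_sym.
apply: (cong_join hE E1 (t := ikj)); last exact: word_join wjik wikj wkji _ _.
by apply: is_join_le; apply: word_le wijk wikj _.
Qed.

(** The same hexagon, with the edges ijk - ikj and jki - kji contracted. *)
Lemma kept_left : ~~ kept E j k D -> ~~ kept E i k D.
Proof.
move=> nk.
have [ijk wijk] := @word_exists 0 1 2 isT isT isT isT isT isT.
have [jik wjik] := @word_exists 1 0 2 isT isT isT isT isT isT.
have [jki wjki] := @word_exists 2 0 1 isT isT isT isT isT isT.
have [ikj wikj] := @word_exists 0 2 1 isT isT isT isT isT isT.
have [kij wkij] := @word_exists 1 2 0 isT isT isT isT isT isT.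
have [kji wkji] := @word_exists 2 1 0 isT isT isT isT isT isT.
have iT : i \in T by rewrite !inE eqxx.
have jT : j \in T by rewrite !inE eqxx orbT.
have kT : k \in T by rewrite !inE eqxx !orbT.
have E1 : E ijk ikj.
  by rewrite (word_cong wijk wikj jT kT) ?(word_bef wijk) ?(word_bef wikj) // ltnn.
have E2 : E jki kji.
  by rewrite (word_cong wjki wkji jT kT) ?(word_bef wjki) ?(word_bef wkji) // ltnn.
have [jD|jD] := boolP (j \in D).
  have <- : E jik jki = ~~ kept E i k D.
    by rewrite (word_cong wjik wjki iT kT) ?(word_bef wjik) ?(word_bef wjki) ?jD.
  apply: cong_trans (hE) _ _ _ (_ : E jik kji) _; last by rewrite cong_sym.
  apply: (cong_join hE E1 (t := jik)); last exact: word_join wikj wjik wkji _ _.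
  by apply: is_join_le; apply: word_le wijk wjik _.
have <- : E ikj kij = ~~ kept E i k D.
  by rewrite (word_cong wikj wkij iT kT) ?(word_bef wikj) ?(word_bef wkij) ?(negbTE jD).
apply: cong_trans (hE) _ _ _ _ (_ : E ijk kij); first by rewrite cong_sym.
apply: (cong_meet hE E2 (t := kij)); first exact: word_meet wjki wkij wijk _ _.
by apply/is_meetC/is_meet_le; apply: word_le wkij wkji _.
Qed.

End Hexagon.

(** * Linear extensions and the poset of a class *)

Section Kept.
Variables (n : nat) (E : rel 'S_n).
Hypothesis hE : lattice_congruence E.
Implicit Types (x y z i j k a b : 'I_n) (D : {set 'I_n}).

(** A subarc is reached by shortening one end, then the other. *)
Lemma kept_sub x y x' y' D : x <= x' -> x' < y' -> y' <= y ->
  kept E x y D -> kept E x' y' D.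
Proof.
move=> xx' xy' yy'; apply: contraTT => nk.
have x'y : x' < y := leq_trans xy' yy'.
have {}nk : ~~ kept E x' y D.
  have [y'y|yy''] := ltnP y' y; first exact: (kept_right hE xy' y'y nk).
  by have -> : y = y' by apply: val_inj => /=; lia.
have [lxx|x'x] := ltnP x x'; first exact: (kept_left hE lxx x'y nk).
by have -> : x = x' by apply: val_inj => /=; lia.
Qed.

Lemma kept_consecutive x y D : essential E -> y = x.+1 :> nat -> kept E x y D.
Proof.
move=> hess yx; have := hess _ _ yx; rewrite /kept /split_arc.
have -> : open_itv x y = set0 by apply/setP => z; rewrite !inE yx; lia.
by rewrite set0I set0D.
Qed.

Lemma subarc_split x y D (b : quadruple n) : is_arc b -> subarc b (split_arc x y D) ->
  exists x' y', [/\ x <= x', x' < y', y' <= y & b = split_arc x' y' D].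
Proof.
case: b => [[[x' y'] A'] B'] /= /and3P[x'y' /eqP AB /disjoint_setI0 AB0].
case/and5P=> xx' _ yy' /subsetP AD /subsetP BD.
exists x', y'; split=> //; rewrite /split_arc -AB.
have [-> ->] : (A' :|: B') :&: D = A' /\ (A' :|: B') :\: D = B'; last by [].
split; apply/setP => z; have := AD z; have := BD z; move/setP/(_ z): AB0;
  rewrite !inE; case: (z \in A'); case: (z \in B'); case: (z \in D); rewrite ?andbF //=.
all: try by move=> _ _ /(_ isT).
all: try by move=> _ /(_ isT).
Qed.

(** Simplicity, read on intervals: a removed arc contains a minimal removed
    arc, which passes all its inner points on the same side. *)
Lemma kept_simple x y D : simple_congruence E -> x < y -> ~~ kept E x y D ->
  exists a b, [/\ x <= a, a < b, b <= y, ~~ kept E a b D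
    & (forall a' b', a <= a' -> a' < b' -> b' <= b -> ~~ kept E a' b' D ->
         a' = a /\ b' = b)
      /\ ((forall z, a < z < b -> z \in D) \/ (forall z, a < z < b -> z \notin D))].
Proof.
move=> hs; have [m] := ubnP (y - x); elim: m x y => // m IH x y ym xy nk.
pose strict (p : 'I_n * 'I_n) :=
  [&& x <= p.1, p.1 < p.2, p.2 <= y, ~~ kept E p.1 p.2 D & p != (x, y)].
have [[a b] /and5P[/= xa ab lby nkab nab]|none] := pickP strict.
  have lt : b - a < m.
    suff : b - a < y - x by move: ym; lia.
    move: nab; rewrite xpair_eqE !ord_eqE; lia.
  have [a' [b' [aa' ab' bb' nk' h]]] := IH a b lt ab nkab.
  by exists a', b'; split=> //; [apply: leq_trans aa'|apply: leq_trans lby].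
exists x, y; split=> //; split=> [a b xa ab lby nkab|].
  have := none (a, b); rewrite /strict /= xa ab lby nkab /=.
  by move/negbFE/eqP => [-> ->].
have [|i [j ij]] := hs (split_arc x y D) (is_arc_split D xy) nk.
  move=> b barc bsub bneq; have [x' [y' [xx' xy' yy' bE]]] := subarc_split barc bsub.
  rewrite bE -/(kept E x' y' D); apply: contraT => nk'.
  have := none (x', y'); rewrite /strict /= xx' xy' yy' nk' /=.
  move/negbFE/eqP => [x'E y'E]; move: bneq; rewrite bE x'E y'E.
  by rewrite eqxx.
case: ij; rewrite /split_arc /up_arc /down_arc => -[-> ->].
  move=> _ /setP h; left => z zxy; have := h z.
  by rewrite !inE zxy andbT => /negbFE.
by move=> /setP h _; right => z zxy; have := h z; rewrite !inE zxy /= => ->.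
Qed.

End Kept.

Section Poset.
Variables (n : nat) (E : rel 'S_n) (P : rel 'I_n).
Hypothesis hE : lattice_congruence E.
Hypothesis hP : congruence_poset E P.
Implicit Types (s t : 'S_n) (x y z i j k a b : 'I_n) (D : {set 'I_n}).

Lemma linear_extensionP (Q : rel 'I_n) s :
  is_linear_extension Q s <-> (forall i j, i != j -> Q i j -> bef s i j).
Proof.
split=> h i j; last first.
  by have [-> //|nij /(h _ _ nij)/ltnW] := eqVneq i j.
move=> nij /h; rewrite leq_eqVlt => /orP[/eqP/val_inj/perm_inj ij|//].
by rewrite ij eqxx in nij.
Qed.

Lemma swap_linear_extension (Q : rel 'I_n) s t x y :
  is_linear_extension Q s -> swap s t x y -> ~~ Q x y -> is_linear_extension Q t.
Proof.
move=> /linear_extensionP sQ [sxy tyx tE] nQ; apply/linear_extensionP => i j ij Qij.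
have sij := sQ _ _ ij Qij; rewrite tE //; first by apply: contraNneq nQ => -[<- <-].
by apply: contraTneq sij => -[-> ->]; rewrite bef_asym ?sxy //; apply: contraTneq sxy => ->; rewrite bef_irr.
Qed.

Definition height (Q : rel 'I_n) x := #|[set z | Q z x]|.

Lemma height_le (Q : rel 'I_n) x : height Q x < n.+1.
Proof. by rewrite ltnS -[X in _ <= X]card_ord max_card. Qed.

Lemma height_mono (Q : rel 'I_n) x y : is_poset Q -> x != y -> Q x y ->
  height Q x < height Q y.
Proof.
case=> Qr Qa Qt xy Qxy; apply: proper_card; apply/properP; split.
  by apply/subsetP => z; rewrite !inE => zx; apply: Qt Qxy.
exists y; rewrite inE ?Qr //; apply: contra xy => Qyx.
by apply/eqP/Qa; rewrite Qxy.
Qed.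

Lemma linear_extension_exists (Q : rel 'I_n) :
  is_poset Q -> exists s, is_linear_extension Q s.
Proof.
move=> Qpo; have [s sE] := perm_of_key (height Q); exists s.
by apply/linear_extensionP => i j ij Qij; rewrite sE (height_mono Qpo ij Qij).
Qed.

(** List [D] first, then [x] and [y], then the rest, both outer parts by
    increasing height. *)
Lemma linear_extension_after D x y (Q : rel 'I_n) :
    is_poset Q -> x \notin D -> y \notin D -> x != y -> ~~ Q y x ->
    (forall z w, Q z w -> w \in D -> z \in D) ->
    (forall z, Q z x || Q z y -> z \in D \/ z = x \/ z = y) ->
  exists s, [/\ is_linear_extension Q s, bef s x y
    & forall z, z != x -> z != y ->
        bef s z x = (z \in D) /\ bef s z y = (z \in D)].
Proof.
move=> Qpo xD yD xy nyx Dd xyd.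
pose key z := if z \in D then height Q z else if z == x then n.+1
  else if z == y then n.+2 else n + 3 + height Q z.
have [s sE] := perm_of_key key.
have kx : key x = n.+1 by rewrite /key (negbTE xD) eqxx.
have ky : key y = n.+2 by rewrite /key (negbTE yD) eq_sym (negbTE xy) eqxx.
exists s; split.
- apply/linear_extensionP => i j ij Qij; rewrite sE.
  suff -> : key i < key j by [].
  have hij := height_mono Qpo ij Qij; have := height_le Q i; have := height_le Q j.
  have [jD|jD] := boolP (j \in D); first by rewrite /key jD (Dd _ _ Qij jD).
  have [jx|jx] := eqVneq j x.
    rewrite jx kx; have [|iD|[iE|iE]] := xyd i; first by rewrite -jx Qij.
    + by rewrite /key iD; lia.
    + by rewrite iE jx eqxx in ij.
    + by rewrite iE jx (negbTE nyx) in Qij.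
  have [jy|jy] := eqVneq j y.
    rewrite jy ky; have [|iD|[iE|iE]] := xyd i; first by rewrite -jy Qij orbT.
    + by rewrite /key iD; lia.
    + by rewrite iE kx.
    + by rewrite iE jy eqxx in ij.
  rewrite {2}/key (negbTE jD) (negbTE jx) (negbTE jy) /key.
  by case: ifP => _; [|case: ifP => _; [|case: ifP => _]]; lia.
- by rewrite sE kx ky ltnS leqnn.
- move=> z zx zy; rewrite !sE kx ky /key (negbTE zx) (negbTE zy).
  have := height_le Q z; case: (z \in D) => h; split; lia.
Qed.

(** List first the points below [y]: [x] is not one of them. *)
Lemma linear_extension_before x y (Q : rel 'I_n) : is_poset Q -> ~~ Q x y ->
  exists s, is_linear_extension Q s /\ bef s y x.
Proof.
move=> Qpo nxy; have [Qr _ Qt] := Qpo.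
pose key z := if Q z y then height Q z else n.+1 + height Q z.
have [s sE] := perm_of_key key; exists s; split.
  apply/linear_extensionP => i j ij Qij; rewrite sE.
  suff -> : key i < key j by [].
  have hij := height_mono Qpo ij Qij; have := height_le Q i; rewrite /key.
  case: ifP => Qiy; case: ifP => Qjy; try lia.
  by rewrite (Qt _ _ _ Qij Qjy) in Qiy.
rewrite sE /key Qr (negbTE nxy); have := height_le Q y; lia.
Qed.

Let Ppo : is_poset P. Proof. by case: hP. Qed.

Lemma linear_extension_cong s t :
  is_linear_extension P s -> is_linear_extension P t <-> E s t.
Proof.
case: hP => _ [r rP] /rP rs; split=> [/rP rt|st].
  by apply: cong_trans (hE) _ _ _ _ rt; rewrite cong_sym.
by apply/rP; apply: cong_trans (hE) _ _ _ rs st.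
Qed.

(** Some linear extension lists [D], then [x] and [y]; swapping these two
    entries stays in the class exactly when they are incomparable. *)
Lemma kept_comparable D x y : x < y -> x \notin D -> y \notin D ->
    (forall z w, P z w -> w \in D -> z \in D) ->
    (forall z, P z x || P z y -> z \in D \/ z = x \/ z = y) ->
  kept E x y D = P x y || P y x.
Proof.
move=> xy xD yD Dd xyd; have nxy : x != y by rewrite ord_eqE ltn_eqF.
have [Pr Pa Pt] := Ppo.
have gap u v s : (forall z, z != u -> z != v ->
      bef s z u = (z \in D) /\ bef s z v = (z \in D)) ->
    forall z, bef s u z -> bef s z v -> False.
  move=> sD z suz szv.
  have zu : z != u by apply: contraTneq suz => ->; rewrite bef_irr.
  have zv : z != v by apply: contraTneq szv => ->; rewrite bef_irr.
  by move: szv suz; rewrite (bef_asym _ zu); case: (sD z zu zv) => -> -> ->.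
have [nyx|Pyx] := boolP (~~ P y x).
  have [s [sP sxy sD]] := linear_extension_after Ppo xD yD nxy nyx Dd xyd.
  have [t sw] := swap_exists sxy (gap _ _ _ sD).
  have -> : kept E x y D = ~~ E s t.
    by rewrite (cong_swap hE sw xy (D := D)) ?negbK // => z zx zy; case: (sD z zx zy).
  rewrite (negbTE nyx) orbF; apply: negb_inj; rewrite negbK.
  apply/idP/idP => [/(linear_extension_cong t sP) tP|nPxy].
    apply/negP => /(proj1 (linear_extensionP _ _) tP _ _ nxy).
    by case: sw => _ tyx _ /bef_trans/(_ tyx); rewrite bef_irr.
  exact/(linear_extension_cong t sP)/(swap_linear_extension sP sw nPxy).
rewrite negbK in Pyx; have nyx : y != x by rewrite eq_sym.
have nPxy : ~~ P x y by apply: contra nxy => Pxy; apply/eqP/Pa; rewrite Pxy.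
have yxd z : P z y || P z x -> z \in D \/ z = y \/ z = x.
  by rewrite orbC => /xyd; tauto.
have [s [sP syx sD]] := linear_extension_after Ppo yD xD nyx nPxy Dd yxd.
have [t sw] := swap_exists syx (gap _ _ _ sD).
have -> : kept E x y D = ~~ E s t.
  by rewrite (cong_swap_down hE sw xy (D := D)) ?negbK // => z zx zy; case: (sD z zy zx).
rewrite Pyx orbT; apply/negP => /(linear_extension_cong t sP).
move=> /(linear_extensionP _ _)/(_ _ _ nyx Pyx); case: sw => _ txy _.
by move/bef_trans/(_ txy); rewrite bef_irr.
Qed.

(** Otherwise one linear extension has [j] before [i], and another one has [j]
    after [k]. Their join belongs to the class and has both inversions, hence
    [k] before [i]. *)
Lemma weak_interval_up i j k : i < j -> j < k -> P i k -> P i j || P j k.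
Proof.
move=> ij jk Pik; apply: contraT; rewrite negb_or => /andP[nij njk].
have [s [sP sji]] := linear_extension_before Ppo nij.
have [t [tP tkj]] := linear_extension_before Ppo njk.
have [m jm] := join_exists s t.
have mP : is_linear_extension P m.
  apply/(linear_extension_cong m tP); have st := (linear_extension_cong t sP).1 tP.
  by rewrite cong_sym //; apply: (cong_join hE st jm); apply/is_join_le/weak_le_refl.
case: jm => /weak_leP sm /weak_leP tm _.
have nik : i != k by rewrite ord_eqE; move: ij jk; lia.
have := (linear_extensionP _ _).1 mP _ _ nik Pik.
by rewrite (bef_asym _ (_ : k != i)) 1?eq_sym // (bef_trans (tm _ _ jk tkj) (sm _ _ ij sji)).
Qed.

(** Dually, the meet of two linear extensions would have [i] before [k]. *)
Lemma weak_interval_down i j k : i < j -> j < k -> P k i -> P k j || P j i.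
Proof.
move=> ij jk Pki; apply: contraT; rewrite negb_or => /andP[nkj nji].
have [s [sP sjk]] := linear_extension_before Ppo nkj.
have [t [tP tij]] := linear_extension_before Ppo nji.
have [m jm] := meet_exists s t.
have mP : is_linear_extension P m.
  apply/(linear_extension_cong m tP); have st := (linear_extension_cong t sP).1 tP.
  by rewrite cong_sym //; apply: (cong_meet hE st jm); apply/is_meet_le/weak_le_refl.
case: jm => ms mt _.
have nki : k != i by rewrite ord_eqE; move: ij jk; lia.
have := (linear_extensionP _ _).1 mP _ _ nki Pki.
rewrite (bef_asym _ (_ : i != k)) 1?eq_sym //.
by rewrite (bef_trans (weak_le_noninv mt ij tij) (weak_le_noninv ms jk sjk)).
Qed.

End Poset.

(** * The Hasse diagram of the poset of a class *)

(** The relation whose connected components are the subtrees hanging at [j]: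
    [component T j k] is convertible to the set of points connected to [k] by
    [avoid (undirected T) j]. *)
Definition avoid (X : finType) (g : rel X) (j : X) : rel X :=
  [rel u v | [&& g u v, u != j & v != j]].

Section Graph.
Variables (X : finType) (g : rel X).
Hypothesis gsym : symmetric g.
Implicit Types (j u v x : X).

Lemma avoid_sym j : symmetric (avoid g j).
Proof. by move=> u v; rewrite /avoid /= gsym andbA andbAC -andbA. Qed.

Lemma path_avoid j x s : path g x s -> j \notin x :: s -> path (avoid g j) x s.
Proof.
elim: s x => //= y s IH x /andP[xy pys]; rewrite !inE !negb_or.
case/and3P=> jx jy js; rewrite IH ?andbT ?inE ?negb_or ?jy //.
by rewrite /avoid /= xy eq_sym jx eq_sym jy.
Qed.

Lemma path_avoid_mem j x s : path (avoid g j) x s -> x != j -> j \notin x :: s.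
Proof.
elim: s x => [|y s IH] x /=; first by rewrite inE eq_sym.
case/andP=> /and3P[_ xj yj] /IH/(_ yj) h _.
by rewrite in_cons negb_or eq_sym xj.
Qed.

Lemma path_avoid_sub j x s : path (avoid g j) x s -> path g x s.
Proof. by apply: sub_path => u v /and3P[]. Qed.

(** A path joining two neighbours of [j] and avoiding [j] would close up into a
    cycle through [j]. *)
Lemma no_detour j u v : (forall c, ucycle g c -> size c < 3) ->
  irreflexive g -> g j u -> g j v -> u != v -> ~~ connect (avoid g j) u v.
Proof.
move=> acyc girr ju jv uv; apply/negP => /connectP[p0 pp0].
case/shortenP: pp0 => p pp up _ vE.
have nuj : u != j by apply: contraTneq ju => ->; rewrite girr.
have jp := path_avoid_mem pp nuj.
have := acyc (j :: u :: p); rewrite /ucycle (cons_uniq j) jp up /=.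
rewrite rcons_path ju (path_avoid_sub pp) -vE gsym jv /=.
move=> /(_ isT); case: p vE {pp up jp} => //= vE.
by rewrite vE eqxx in uv.
Qed.

End Graph.

(** A discrete intermediate value property. *)
Lemma path_cross n (e : rel 'I_n) (j x : 'I_n) s : symmetric e ->
    path e x s -> j \notin x :: s -> (x < j) != (last x s < j) ->
  exists u v, [/\ u \in x :: s, v \in x :: s, e u v & u < j < v].
Proof.
move=> es; elim: s x => [|y s IH] x /=; first by rewrite eqxx.
case/andP=> xy pys; rewrite in_cons negb_or => /andP[jx jys] cross.
have jy : j != y by apply: contraNneq jys => ->; rewrite inE eqxx.
have [same|diff] := eqVneq (x < j) (y < j).
  have [|u [v [us vs uv h]]] := IH y pys jys; first by rewrite -same.
  by exists u, v; rewrite !(in_cons x) us vs !orbT.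
move: diff jx jy; rewrite !ord_eqE => diff jx jy.
have [xj|jx'] := ltnP x j.
  by exists x, y; split; rewrite ?inE ?eqxx ?orbT //; move: diff jy; lia.
by exists y, x; split; rewrite ?inE ?eqxx ?orbT // 1?es //; move: diff jx; lia.
Qed.

Lemma undirected_sym n (T : rel 'I_n) : symmetric (undirected T).
Proof. by move=> u v; rewrite /undirected orbC. Qed.

Section Components.
Variables (n : nat) (T : rel 'I_n).
Implicit Types (j p x a b : 'I_n).

Lemma component_neq j p x : p != j -> x \in component T j p -> x != j.
Proof.
move=> pj; rewrite inE => /connectP[s /path_avoid_mem/(_ pj) + ->].
by apply: contraNneq => <-; apply: mem_last.
Qed.

Lemma component_sym j p x : (x \in component T j p) = (p \in component T j x).
Proof.
by rewrite !inE; apply/sym_connect_sym/avoid_sym/undirected_sym.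
Qed.

Lemma component_trans j p x y :
  x \in component T j p -> y \in component T j x -> y \in component T j p.
Proof. by rewrite !inE; apply: connect_trans. Qed.

Lemma mem_component j p : p \in component T j p.
Proof. by rewrite inE connect0. Qed.

Lemma component_op j p : component (fun u v => T v u) j p = component T j p.
Proof.
apply/setP => x; rewrite !inE; apply: eq_connect => u v /=.
by rewrite /undirected orbC.
Qed.

Lemma connect_component j a b :
    (forall z, connect T a z -> connect T z b -> z != j) -> connect T a b ->
  b \in component T j a.
Proof.
move=> h /connectP[p]; rewrite inE; elim: p a h => [|y p IH] a h /=.
  by move=> _ ->; apply: connect0.
case/andP=> ay pyp bE.
have yb : connect T y b by apply/connectP; exists p.
apply: (@connect_trans _ _ y); last first.
  by apply: IH => // z yz zb; apply: h zb; apply: connect_trans yz; apply: connect1.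
apply: connect1; rewrite /= /undirected ay /=; apply/andP; split.
  by apply: h; [apply: connect0|apply: connect_trans yb; apply: connect1].
by apply: h yb; apply: connect1.
Qed.

Lemma connect_last a b : connect T a b -> a != b ->
  exists2 c, connect T a c & T c b.
Proof.
move=> /connectP[p]; case/lastP: p => [|p c]; first by move=> _ ->; rewrite eqxx.
rewrite rcons_path last_rcons => /andP[pp cb] -> _.
by exists (last a p) => //; apply/connectP; exists p.
Qed.

End Components.

Section Core.
Variable n : nat.
Implicit Types (x y z w j p q a b i k l r : 'I_n) (D : {set 'I_n}).

(** What the proof uses of a class of a simple essential congruence: [K x y D]
    says that the arc from [x] to [y] passing the points of [D] on the left
    and the others on the right belongs to the congruence, and [P] is the
    poset of the class. The conditions are invariant under reversing [P] and
    exchanging left and right. *)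
Record class_poset (K : 'I_n -> 'I_n -> {set 'I_n} -> bool) (P : rel 'I_n) : Prop :=
  ClassPoset {
    cp_poset : is_poset P;
    cp_ext : forall x y D D',
      (forall z, x < z < y -> (z \in D) = (z \in D')) -> K x y D = K x y D';
    cp_sub : forall x y x' y' D, x <= x' -> x' < y' -> y' <= y ->
      K x y D -> K x' y' D;
    cp_simple : forall x y D, x < y -> ~~ K x y D ->
      exists a b, [/\ x <= a, a < b, b <= y, ~~ K a b D
        & (forall a' b', a <= a' -> a' < b' -> b' <= b -> ~~ K a' b' D ->
             a' = a /\ b' = b)
          /\ ((forall z, a < z < b -> z \in D) \/
              (forall z, a < z < b -> z \notin D))];
    cp_consecutive : forall x y D, y = x.+1 :> nat -> K x y D;
    cp_comparable : forall x y D, x < y -> x \notin D -> y \notin D ->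
      (forall z w, P z w -> w \in D -> z \in D) ->
      (forall z, P z x || P z y -> z \in D \/ z = x \/ z = y) ->
      K x y D = P x y || P y x;
    cp_up : forall i j k, i < j -> j < k -> P i k -> P i j || P j k;
    cp_down : forall i j k, i < j -> j < k -> P k i -> P k j || P j i
  }.

(** The complement of [D] consists, besides [x] and [y], of a down set of the
    original poset when [D] is a down set of the reversed one. *)
Lemma class_poset_op K P : class_poset K P ->
  class_poset (fun x y D => K x y (~: D)) (fun x y => P y x).
Proof.
case=> [[Pr Pa Pt] ext sub simple cons comp up down]; split.
- split=> [x|x y xy|y x z xy yz]; [exact: Pr|by apply: Pa; rewrite andbC|exact: Pt yz xy].
- by move=> x y D D' DD'; apply: ext => z /DD'; rewrite !inE => ->.
- by move=> x y x' y' D; apply: sub.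
- move=> x y D xy /(simple _ _ _ xy)[a [b [xa ab lby nk [h1 h2]]]].
  exists a, b; split=> //; split=> //; case: h2 => h; [right|left] => z /h;
  by rewrite inE ?negbK.
- by move=> x y D; apply: cons.
- move=> x y D xy xD yD Dd xyd; rewrite orbC.
  rewrite (ext _ _ _ (~: D :\ x :\ y)); last first.
    move=> z zxy; rewrite !inE !ord_eqE; case: (z \in D); rewrite ?andbF //=.
    by move: zxy; lia.
  have nyx : y != x by rewrite ord_eqE gtn_eqF.
  apply: comp => //; rewrite ?inE ?eqxx ?andbF //.
    move=> z w zw; rewrite !inE => /and3P[wy wx wD].
    have zD : z \notin D by apply: contra wD; apply: Dd.
    rewrite zD andbT; apply/andP; split; apply: contraNneq wD => zE.
      have [//|[] wE] : w \in D \/ w = x \/ w = y by apply: xyd; rewrite -zE zw orbT.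
        by rewrite wE eqxx in wx.
      by rewrite wE eqxx in wy.
    have [//|[] wE] : w \in D \/ w = x \/ w = y by apply: xyd; rewrite -zE zw.
      by rewrite wE eqxx in wx.
    by rewrite wE eqxx in wy.
  move=> z zxy; rewrite !inE.
  have [->|zy] := eqVneq z y; first by right; right.
  have [->|zx] := eqVneq z x; first by right; left.
  left; apply/negP => zD; case/orP: zxy => h.
    by rewrite (Dd _ _ h zD) in xD.
  by rewrite (Dd _ _ h zD) in yD.
- by move=> i j k ij jk /(down _ _ _ ij jk); rewrite orbC.
- by move=> i j k ij jk /(up _ _ _ ij jk); rewrite orbC.
Qed.

Lemma hasse_op (P : rel 'I_n) x y : hasse (fun u v => P v u) x y = hasse P y x.
Proof.
rewrite /hasse eq_sym; congr [&& _, _ & _].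
by apply: eq_forallb => z; rewrite andbC orbC.
Qed.

End Core.

Section Hasse.
Variables (n : nat) (K : 'I_n -> 'I_n -> {set 'I_n} -> bool) (P T : rel 'I_n).
Hypothesis cp : class_poset K P.
Hypothesis hT : T =2 hasse P.
Implicit Types (x y z w j p q a b i k l r : 'I_n) (D : {set 'I_n}).

Let Pr : reflexive P. Proof. by case: (cp_poset cp). Qed.
Let Pa x y : P x y -> P y x -> x = y.
Proof. by case: (cp_poset cp) => _ h _ xy yx; apply: h; rewrite xy. Qed.
Let Pt : transitive P. Proof. by case: (cp_poset cp). Qed.

Lemma hasse_le x y : T x y -> P x y.
Proof. by rewrite hT => /and3P[]. Qed.

Lemma hasse_neq x y : T x y -> x != y.
Proof. by rewrite hT => /and3P[]. Qed.

Lemma hasse_cover x y z : T x y -> P x z -> P z y -> z = x \/ z = y.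
Proof.
rewrite hT => /and3P[_ _ /forallP/(_ z)/implyP h] xz zy.
by have /orP[/eqP|/eqP] := h (introT andP (conj xz zy)); [left|right].
Qed.

Lemma hasse_irr x y : T x y -> ~~ T y x.
Proof.
move=> xy; apply: contra (hasse_neq xy) => /hasse_le yx.
by apply/eqP/(Pa (hasse_le xy)).
Qed.

(** By induction on the number of points between [x] and [y]. *)
Lemma connect_hasse x y : connect T x y = P x y.
Proof.
apply/idP/idP => [/connectP[p]|].
  elim: p x => [x _ -> //|z p IH x] /= /andP[/hasse_le xz pz] yE.
  exact: Pt xz (IH _ pz yE).
have [m] := ubnP #|[set z | P x z && P z y]|; elim: m x y => // m IH x y.
rewrite ltnS => card Pxy; have [->//|nxy] := eqVneq x y.
case hxy : (T x y); first exact: connect1.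
move: hxy; rewrite hT /hasse nxy Pxy /= => /negbT/forallPn[z].
rewrite negb_imply negb_or => /andP[/andP[xz zy] /andP[nzx nzy]].
apply: (@connect_trans _ _ z); apply: IH => //; apply: leq_trans card.
  apply: proper_card; apply/properP; split.
    by apply/subsetP => w; rewrite !inE => /andP[-> /Pt]; apply.
  exists y; rewrite !inE ?Pxy ?Pr //; apply: contra nzy => /andP[_ yz].
  exact/eqP/Pa.
apply: proper_card; apply/properP; split.
  by apply/subsetP => w; rewrite !inE => /andP[zw ->]; rewrite (Pt xz zw).
exists x; rewrite !inE ?Pxy ?Pr //; apply: contra nzx => /andP[zx _].
by apply/eqP/Pa.
Qed.

(** The smallest set that can be listed before [x] and [y] when these are to
    be consecutive entries of a linear extension. *)
Definition below x y : {set 'I_n} :=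
  [set z | [&& z != x, z != y & P z x || P z y]].

Lemma kept_below x y : x < y ->
    (forall w, P x w -> P w y -> w = x \/ w = y) ->
    (forall w, P y w -> P w x -> w = x \/ w = y) ->
  K x y (below x y) = P x y || P y x.
Proof.
move=> xy hxy hyx; apply: (cp_comparable cp) => //; rewrite ?inE ?eqxx ?andbF //.
  move=> z w zw; rewrite !inE => /and3P[wx wy wxy].
  have -> : P z x || P z y by case/orP: wxy => /(Pt zw)->; rewrite ?orbT.
  rewrite andbT; apply/andP; split; apply: contraTneq zw => ->; apply/negP => h;
    case/orP: wxy => h'.
  - by rewrite (Pa h h') eqxx in wx.
  - by case: (hxy _ h h') => wE; rewrite wE eqxx in wx wy.
  - by case: (hyx _ h h') => wE; rewrite wE eqxx in wx wy.
  - by rewrite (Pa h h') eqxx in wy.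
move=> z zxy; rewrite !inE zxy andbT.
have [->|_] := eqVneq z x; first by right; left.
by have [->|_] := eqVneq z y; [right; right|left].
Qed.

Lemma kept_edge x y : x < y -> undirected T x y -> K x y (below x y).
Proof.
move=> xy Txy; rewrite kept_below //.
- by case/orP: Txy => /hasse_le ->; rewrite ?orbT.
- move=> w xw wy; case/orP: Txy => Txy; first exact: hasse_cover Txy xw wy.
  have := Pt (Pt wy (hasse_le Txy)) xw; left; apply: Pa xw; exact: Pt wy (hasse_le Txy).
- move=> w yw wx; case/orP: Txy => Txy; last by case: (hasse_cover Txy yw wx); tauto.
  left; apply: Pa wx _; exact: Pt (hasse_le Txy) yw.
Qed.

Lemma kept_incomparable x y : x < y -> ~~ P x y -> ~~ P y x -> ~~ K x y (below x y).
Proof.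
move=> xy nxy nyx; rewrite kept_below ?(negbTE nxy) ?(negbTE nyx) // => w h h'.
  by rewrite (Pt h h') in nxy.
by rewrite (Pt h h') in nyx.
Qed.

Section Fork.
Variables j p q : 'I_n.
Hypotheses (jp : T j p) (jq : T j q) (pq : p < q).

Let npq : ~~ P p q.
Proof.
apply/negP => h; have [pE|pE] := hasse_cover jq (hasse_le jp) h.
  by have := hasse_neq jp; rewrite pE eqxx.
by move: pq; rewrite pE ltnn.
Qed.

Let nqp : ~~ P q p.
Proof.
apply/negP => h; have [pE|pE] := hasse_cover jp (hasse_le jq) h.
  by have := hasse_neq jq; rewrite pE eqxx.
by move: pq; rewrite pE ltnn.
Qed.

(* The points below [p] or [q] other than [j]: after them, [j] can be followed
   by [p] or by [q]. *)
Let D0 := below p q :\ j.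

Let D0down z w : P z w -> w \in D0 -> z \in D0.
Proof.
rewrite !inE => zw /and4P[wj wp wq wpq].
have zpq : P z p || P z q by case/orP: wpq => /(Pt zw)->; rewrite ?orbT.
rewrite zpq andbT; apply/and3P; split; apply: contraTneq zw => ->; apply/negP => h; case/orP: wpq => h'.
- by case: (hasse_cover jp h h') => wE; rewrite wE eqxx in wj wp.
- by case: (hasse_cover jq h h') => wE; rewrite wE eqxx in wj wq.
- by rewrite (Pa h h') eqxx in wp.
- by move: npq; rewrite (Pt h h').
- by move: nqp; rewrite (Pt h h').
- by rewrite (Pa h h') eqxx in wq.
Qed.

Let D0_p z : P z j || P z p -> z \in D0 \/ z = j \/ z = p.
Proof.
move=> h; have zp : P z p by case/orP: h => // /Pt; apply; apply: hasse_le.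
rewrite !inE zp /= andbT.
have [->|_] := eqVneq z j; first by right; left.
have [->|_] := eqVneq z p; first by right; right.
by left; apply: contraTneq zp => ->.
Qed.

Let D0_q z : P z j || P z q -> z \in D0 \/ z = j \/ z = q.
Proof.
move=> h; have zq : P z q by case/orP: h => // /Pt; apply; apply: hasse_le.
rewrite !inE zq orbT andbT.
have [->|_] := eqVneq z j; first by right; left.
have [->|_] := eqVneq z q; first by right; right.
by left; rewrite andbT; apply: contraTneq zq => ->.
Qed.

Let jD0 : j \notin D0. Proof. by rewrite !inE eqxx. Qed.
Let pD0 : p \notin D0. Proof. by rewrite !inE eqxx /= andbF. Qed.
Let qD0 : q \notin D0. Proof. by rewrite !inE eqxx /= !andbF. Qed.

Let kept_p : if j < p then K j p D0 else K p j D0.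
Proof.
have jpne := hasse_neq jp; case: ifP => h.
  by rewrite (cp_comparable cp) // (hasse_le jp).
have h' : p < j by rewrite ltn_neqAle -ord_eqE eq_sym jpne leqNgt h.
rewrite (cp_comparable cp) ?(hasse_le jp) ?orbT //.
by move=> z; rewrite orbC => /D0_p; tauto.
Qed.

Let kept_q : if j < q then K j q D0 else K q j D0.
Proof.
have jqne := hasse_neq jq; case: ifP => h.
  by rewrite (cp_comparable cp) // (hasse_le jq).
have h' : q < j by rewrite ltn_neqAle -ord_eqE eq_sym jqne leqNgt h.
rewrite (cp_comparable cp) ?(hasse_le jq) ?orbT //.
by move=> z; rewrite orbC => /D0_q; tauto.
Qed.

Let kept_pq : ~~ K p q (below p q).
Proof. exact: kept_incomparable. Qed.

(** If [p] and [q] were on the same side of [j], the arc of [p] and [q] would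
    be part of the arc joining [j] to the farther of them. *)
Lemma fork_parents : p < j < q.
Proof.
have D0E : ~~ (p < j < q) -> K p q D0 = K p q (below p q).
  move=> njj; apply: (cp_ext cp) => z zpq; rewrite [in LHS]inE in_set1.
  by case: eqVneq zpq njj => // -> ->.
apply: contraT => nj; move: kept_pq; rewrite -D0E //.
have [jltp|plej] := ltnP j p.
  have jltq := ltn_trans jltp pq; move: kept_q; rewrite jltq => h.
  by rewrite (cp_sub cp _ _ _ h) // ltnW.
have pltj : p < j by rewrite ltn_neqAle plej andbT -ord_eqE eq_sym hasse_neq.
move: nj; rewrite pltj /= -leqNgt => qj.
move: kept_p; rewrite ltnNge ltnW //= => h.
by rewrite (cp_sub cp _ _ _ h).
Qed.

(** The arc of [p] and [q] just above [j] is removed, so it contains a minimal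
    removed up or down arc from [a] to [b]. It must go over [j], because the
    arcs from [j] to [p] and to [q] are kept: it is an up arc. Minimality then
    forces all the points it passes to be below [j]: the last one before [j]
    that is not would form with [j] a smaller removed arc. *)
Lemma fork_up_arc : exists a b,
  [/\ p <= a, a < j, j < b, b <= q
    & (forall z, a < z < b -> P z j) /\ ~~ K a b setT].
Proof.
have /andP[pj jltq] := fork_parents.
have [a [b [pa ab bq nab [amin hom]]]] := cp_simple cp pq kept_pq.
have D0E x y : x = j \/ y = j -> K x y D0 = K x y (below p q).
  move=> xy; apply: (cp_ext cp) => z zxy; rewrite [in LHS]inE in_set1.
  by case: eqVneq zxy => // ->; case: xy => ->; rewrite ltnn ?andbF.
have aj : a < j.
  rewrite ltnNge; apply: contra nab => ja.
  move: kept_q; rewrite jltq D0E; last by left.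
  exact: (cp_sub cp).
have jb : j < b.
  rewrite ltnNge; apply: contra nab => bj.
  move: kept_p; rewrite ltnNge ltnW //= D0E; last by right.
  exact: (cp_sub cp).
have abD z : a < z < b -> z \in below p q.
  case: hom => [h /h //|/(_ j)]; rewrite aj jb => /(_ isT).
  by rewrite !inE (hasse_neq jp) (hasse_neq jq) hasse_le.
have nP z : a < z < b -> z != j -> ~~ P j z.
  move=> /abD; rewrite !inE => /and3P[zp zq zpq] zj; apply/negP => jz.
  by case/orP: zpq => h; [case: (hasse_cover jp jz h)|case: (hasse_cover jq jz h)] => zE;
    rewrite zE eqxx in zp zq zj.
have incK x y : x < y -> a <= x -> y <= b -> ~~ P x y -> ~~ P y x ->
    (forall w, x < w < y -> P w x || P w y) -> x = a /\ y = b.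
  move=> xy ax yb nxy nyx h; apply: amin => //.
  have := kept_incomparable xy nxy nyx; apply: contra.
  rewrite (cp_ext cp (D' := below x y)) // => w wxy.
  rewrite abD; last by move: wxy ax yb; clear; lia.
  by rewrite inE h // !ord_eqE; move: wxy; clear; lia.
exists a, b; split=> //; split; last first.
  move: nab; rewrite (cp_ext cp (D' := setT)) // => z /abD ->.
  by rewrite inE.
have left_ z : a < z < j -> P z j.
  have [m] := ubnP (j - z); elim: m z => // m IH z zm zaj.
  apply: contraT => nzj.
  have [||||||za _] := incK z j; try by move: zaj jb; clear; lia.
  - exact: nzj.
  - by apply: nP; [move: zaj jb|rewrite ord_eqE; move: zaj]; clear; lia.
  - by move=> w wzj; rewrite IH ?orbT //; move: wzj zaj zm; clear; lia.
  - by move: zaj; rewrite za ltnn.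
have right_ z : j < z < b -> P z j.
  have [m] := ubnP (z - j); elim: m z => // m IH z zm zaj.
  apply: contraT => nzj.
  have [||||||_ za] := incK j z; try by move: zaj aj; clear; lia.
  - by apply: nP; [move: zaj aj|rewrite ord_eqE; move: zaj]; clear; lia.
  - exact: nzj.
  - by move=> w wzj; rewrite IH //; move: wzj zaj zm; clear; lia.
  - by move: zaj; rewrite za ltnn andbF.
move=> z /andP[az zb]; have [zj|jz|/val_inj->] := ltngtP z j; last exact: Pr.
  by apply: left_; rewrite az.
by apply: right_; rewrite jz.
Qed.

(** An edge across [j] either has an end in the interval of the removed up
    arc, or spans this interval; in the second case its own arc is kept, hence
    does not pass all these points on the left, so neither end is above
    [j]. *)
Lemma fork_crossing x y : undirected T x y -> x < j < y -> P x j || P y j.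
Proof.
move=> Txy /andP[xj jy]; have [a [b [pa aj jb bq [abj nab]]]] := fork_up_arc.
have [ax|xa] := ltnP a x; first by rewrite abj // ax (ltn_trans xj).
have [yb|lby] := ltnP y b; first by rewrite (abj y) ?orbT // yb (ltn_trans aj).
have [/orP jxy|] := boolP (P j x || P j y).
  have := kept_edge (ltn_trans xj jy) Txy => /(cp_sub cp xa (ltn_trans aj jb) lby).
  rewrite (cp_ext cp (D' := setT)) ?(negbTE nab) // => z zab.
  have zj := abj z zab; rewrite !inE.
  have -> : P z x || P z y by case: jxy => /(Pt zj)->; rewrite ?orbT.
  by rewrite andbT !ord_eqE; move: zab xa lby; clear; lia.
rewrite negb_or => /andP[/negbTE njx /negbTE njy]; case/orP: Txy => /hasse_le h.
  by have := cp_up cp xj jy h; rewrite njy orbF => ->.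
by have := cp_down cp xj jy h; rewrite njx orbF => ->; rewrite orbT.
Qed.

End Fork.

Let undirected_irr : irreflexive (undirected T).
Proof. by move=> x; rewrite /undirected orbb; apply/negP => /hasse_neq; rewrite eqxx. Qed.

(** Two neighbours on a cycle of a [P]-minimal point [j] of this cycle are
    parents of [j], on both sides of it; the rest of the cycle has an edge
    across [j], so it contains a point below [j]. *)
Lemma hasse_acyclic c : ucycle (undirected T) c -> size c < 3.
Proof.
move=> uc; rewrite ltnNge; apply/negP => c3.
have [j jc jmin] : exists2 j, j \in c & forall x, x \in c -> P x j -> x = j.
  case: c {uc} c3 => // x0 c _; pose h x := #|[set z | P z x]|.
  have x0c : x0 \in x0 :: c by rewrite inE eqxx.
  case: (arg_minnP h x0c) => j jc jmin; exists j => // x xc xj.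
  apply/eqP; apply: contraT => nxj; have := jmin x xc; rewrite leqNgt => /negP[].
  apply: proper_card; apply/properP; split.
    by apply/subsetP => z; rewrite !inE => /Pt; apply.
  by exists j; rewrite inE ?Pr //; apply: contra nxj => jx; apply/eqP/Pa.
case/rot_to: jc => m s sE.
have := uc; rewrite -(rot_ucycle m) sE => /andP[].
have sc x : x \in s -> x \in c by move=> xs; rewrite -(mem_rot m) sE inE xs orbT.
have : 2 <= size s by move: c3; rewrite -(size_rot m) sE.
case: s sE sc => [//|p s] sE sc s1; rewrite /= rcons_path.
case/andP=> jp /andP[ps qj] /andP[jps /andP[pns us]].
set q := last p s in qj.
have up x : x \in p :: s -> undirected T j x -> T j x.
  move=> xs /orP[//|xj]; have := jmin x (sc x xs) (hasse_le xj) => xE.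
  by rewrite -xE xs in jps.
have qs : q \in p :: s by apply: mem_last.
have {}jp : T j p by apply: up => //; rewrite inE eqxx.
have jq : T j q by apply: up; rewrite // undirected_sym.
have npq : p != q.
  by apply: contraNneq pns => ->; rewrite /q; case: (s) s1 => //= y s' _; rewrite mem_last.
have [pjq cr] : (p < j) != (q < j) /\
    forall x y, undirected T x y -> x < j < y -> P x j || P y j.
  have /orP[lt|lt] : (p < q) || (q < p) by rewrite -neq_ltn -ord_eqE.
    split=> [|x y]; last exact: (fork_crossing jp jq lt).
    by have /andP[] := fork_parents jp jq lt; clear; lia.
  split=> [|x y]; last exact: (fork_crossing jq jp lt).
  by have /andP[] := fork_parents jq jp lt; clear; lia.
have [u [v [us_ vs uv ujv]]] := path_cross (@undirected_sym _ T) ps jps pjq.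
by case/orP: (cr _ _ uv ujv) => h; [have := jmin u (sc u us_) h|have := jmin v (sc v vs) h];
  move=> E; move: ujv; rewrite E ltnn ?andbF.
Qed.

(** Points below [j] hang from a child of [j], so they lie in no ancestor
    subtree. *)
Lemma ancestor_subtree_not_below j p x :
  T j p -> x \in component T j p -> ~~ P x j.
Proof.
move=> jp px; apply/negP => xj.
have pj : p != j by rewrite eq_sym hasse_neq.
have nxj := component_neq pj px.
rewrite -connect_hasse in xj; have [c xc cj] := connect_last xj nxj.
have cx : c \in component T j x.
  apply: connect_component => // z _; rewrite connect_hasse => zc.
  apply: contraNneq (hasse_neq cj) => zj; apply/eqP/Pa; first exact: hasse_le.
  by rewrite -zj.
have := component_trans px cx; rewrite inE; apply/negP.
apply: (no_detour (@undirected_sym _ T) hasse_acyclic undirected_irr).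
- by rewrite /undirected jp.
- by rewrite /undirected cj orbT.
- by apply: contraTneq cj => <-; apply: hasse_irr.
Qed.

Section ForkSubtrees.
Variables j p q : 'I_n.
Hypotheses (jp : T j p) (jq : T j q) (pq : p < q).

(** Otherwise the subtree contains an edge across [j], hence a point below
    [j]. *)
Lemma ancestor_subtree_side r x :
  T j r -> x \in component T j r -> (x < j) = (r < j).
Proof.
move=> jr rx; have [//|side] := eqVneq (x < j) (r < j); exfalso.
have rj : r != j by rewrite eq_sym hasse_neq.
move: (rx); rewrite inE => /connectP[s ps xE].
have js := path_avoid_mem ps rj; rewrite xE eq_sym in side.
have [u [v [us vs /and3P[uv _ _] ujv]]] :=
  path_cross (avoid_sym (@undirected_sym _ T) j) ps js side.
have comp w : w \in r :: s -> w \in component T j r.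
  by move=> ws; rewrite inE; apply: path_connect ps _ ws.
case/orP: (fork_crossing jp jq pq uv ujv); apply/negP.
  exact: ancestor_subtree_not_below jr (comp _ us).
exact: ancestor_subtree_not_below jr (comp _ vs).
Qed.

Lemma separates_ancestors : separates j (component T j p) (component T j q).
Proof.
have /andP[pj jltq] := fork_parents jp jq pq.
apply/andP; split; apply/forall_inP => x hx; apply/forall_inP => y hy.
  by move: hy; rewrite inE => /eqP->; rewrite (ancestor_subtree_side jp hx).
move: hx; rewrite inE => /eqP->.
have qj : q != j by rewrite eq_sym hasse_neq.
have := ancestor_subtree_side jq hy; have := component_neq qj hy.
by rewrite ord_eqE; move: jltq; clear; lia.
Qed.

(** The points passed by the up arc of [fork_up_arc] are below [j], so neither
    ancestor subtree contains any of them: [l] and [r] are on either side of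
    this arc. *)
Lemma removed_up_arc l r :
  l \in component T j p -> r \in component T j q -> ~~ K l r setT.
Proof.
move=> lp rq; have [a [b [pa aj jb bq [abj nab]]]] := fork_up_arc jp jq pq.
have /andP[/forall_inP/(_ _ lp)/forall_inP/(_ j) lj
           /forall_inP/(_ j)] := separates_ancestors.
rewrite !inE => /(_ (eqxx _))/forall_inP/(_ _ rq) jr; rewrite !inE in lj.
have {}lj := lj (eqxx _).
apply: contra nab; apply: (cp_sub cp) (ltn_trans aj jb) _.
  rewrite leqNgt; apply: contra (ancestor_subtree_not_below jp lp) => al.
  by rewrite abj // al (ltn_trans lj).
rewrite leqNgt; apply: contra (ancestor_subtree_not_below jq rq) => rb.
by rewrite abj // rb (ltn_trans aj).
Qed.

End ForkSubtrees.

Lemma parents_separated j p q : T j p -> T j q -> p != q ->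
  separates j (component T j p) (component T j q) ||
  separates j (component T j q) (component T j p).
Proof.
move=> jp jq; rewrite ord_eqE neq_ltn => /orP[] pq.
  by rewrite (separates_ancestors jp jq pq).
by rewrite (separates_ancestors jq jp pq) orbT.
Qed.

(** Two parents lie on different sides of [j]. *)
Lemma card_parents j : #|parents T j| <= 2.
Proof.
rewrite leqNgt; apply/negP => /card_gt2P[x [y [z [[]]]]].
rewrite !inE => jx jy jz [xy yz zx].
have side p q : T j p -> T j q -> p != q -> (p < j) != (q < j).
  move=> jp jq; rewrite ord_eqE neq_ltn => /orP[] pq.
    by have /andP[] := fork_parents jp jq pq; clear; lia.
  by have /andP[] := fork_parents jq jp pq; clear; lia.
have := side _ _ jx jy xy; have := side _ _ jy jz yz; have := side _ _ jz jx zx.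
by case: (x < j); case: (y < j); case: (z < j).
Qed.

(** Consecutive integers are comparable because the arcs joining them are
    kept. *)
Lemma hasse_connected x y : connect (undirected T) x y.
Proof.
have symc := sym_connect_sym (@undirected_sym _ T).
have step u v : P u v -> connect (undirected T) u v.
  rewrite -connect_hasse; apply: connect_sub => a b ab.
  by apply: connect1; rewrite /undirected ab.
have cons (u v : 'I_n) : v = u.+1 :> nat -> connect (undirected T) u v.
  move=> vu; have uv : u < v by rewrite vu.
  have [/step //|nuv] := boolP (P u v); rewrite symc; apply: step.
  by apply: contraT => /(kept_incomparable uv nuv); rewrite (cp_consecutive cp).
have inc (u v : 'I_n) : u <= v -> connect (undirected T) u v.
  have [m] := ubnP (v - u); elim: m u => // m IH u vum; rewrite leq_eqVlt.
  case/orP=> [/eqP/val_inj->//|uv]; have un : u.+1 < n by apply: leq_trans (ltn_ord v).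
  apply: (@connect_trans _ _ (Ordinal un)); first exact: cons.
  by apply: IH => //=; move: vum uv; clear; lia.
by have [/inc//|/ltnW/inc] := leqP x y; rewrite symc.
Qed.

Lemma hasse_directed_tree : 0 < n -> directed_tree T.
Proof.
move=> n0; split; first exact: hasse_irr.
split=> //; [exact: undirected_sym|exact: hasse_connected|exact: hasse_acyclic].
Qed.

End Hasse.

(** * From posets to admissible trees, and the geometry of separating trees *)

Lemma split_arc_up n (l r : 'I_n) : split_arc l r setT = up_arc l r.
Proof. by rewrite /split_arc setIT setDT. Qed.

Lemma split_arc_down n (l r : 'I_n) : split_arc l r set0 = down_arc l r.
Proof. by rewrite /split_arc setI0 setD0. Qed.

Section Forward.
Variables (n : nat) (E : rel 'S_n) (P T : rel 'I_n).
Hypothesis n_gt0 : 0 < n.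
Hypothesis hE : lattice_congruence E.
Hypothesis hsimple : simple_congruence E.
Hypothesis hess : essential E.
Hypothesis hP : congruence_poset E P.
Hypothesis hT : T =2 hasse P.
Implicit Types (x y z i j k l r p q : 'I_n).

Lemma class_poset_kept : class_poset (kept E) P.
Proof.
split; first by case: hP.
- exact: kept_ext.
- exact: (kept_sub hE).
- by move=> x y D; apply: kept_simple.
- by move=> x y D; apply: kept_consecutive.
- by move=> x y D; apply: (kept_comparable hE hP).
- exact: (weak_interval_up hE hP).
- exact: (weak_interval_down hE hP).
Qed.

Let cp := class_poset_kept.
Let cpo := class_poset_op cp.
Let To : rel 'I_n := fun x y => T y x.
Let hTo : To =2 hasse (fun x y => P y x).
Proof. by move=> x y; rewrite hasse_op /To hT. Qed.

Lemma hasse_separating_tree : separating_tree T.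
Proof.
split; first exact: (hasse_directed_tree cp hT n_gt0).
move=> j; split.
- exact: (card_parents cp hT j).
- exact: (card_parents cpo hTo j).
- by move=> p q; rewrite !inE; apply: (parents_separated cp hT).
- move=> p q; rewrite !inE => pj qj npq.
  by have := parents_separated cpo hTo pj qj npq; rewrite !(component_op T).
Qed.

(** A point above one end and below one end would lie strictly inside the
    cover relation [u -> v], or contradict antisymmetry. *)
Lemma edge_sides u v j : T u v -> j != u -> j != v -> P u j || P j v ->
  (P u j || P v j) = ~~ (P j u || P j v).
Proof.
move=> Tuv ju jv h; have [_ Pa _] := cp_poset cp.
have anti x : j != x -> P x j -> P j x -> False.
  by move=> + xj jx; rewrite (Pa j x) ?eqxx // jx.
have no : P u j -> P j v -> False.
  move=> uj jv'; case: (hasse_cover hT Tuv uj jv') => jE;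
  by rewrite jE eqxx in ju jv.
have := anti u ju; have := anti v jv; move: h no.
case: (P u j); case: (P j v); case: (P v j); case: (P j u) => //= _ no a1 a2.
all: by case: (no isT isT) || case: (a1 isT isT) || case: (a2 isT isT).
Qed.

(** The mandatory arc of an edge is the arc of its ends when they are listed
    just after the points below them. *)
Lemma mandatory_arc_kept a : mandatory_arc T a -> a \in arcs_of E.
Proof.
case=> i [k [ik Tik ->]].
have := kept_edge cp hT ik Tik; rewrite /kept /split_arc.
have itvE j : i < j < k -> (j != i) * (j != k).
  by move=> h; rewrite !ord_eqE; split; move: h; clear; lia.
have -> : open_itv i k :&: below P i k =
    [set j in open_itv i k | connect T j i || connect T j k].
  apply/setP => j; rewrite !inE !(connect_hasse cp hT).
  by case ijk : (i < j < k); rewrite ?(itvE j ijk).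
suff -> : open_itv i k :\: below P i k =
    [set j in open_itv i k | connect T i j || connect T k j] by [].
apply/setP => j; rewrite !inE !(connect_hasse cp hT) andbC.
case ijk : (i < j < k); rewrite //= ?(itvE j ijk) /=.
have /andP[ij jk] := ijk; have [ji jk'] := itvE j ijk.
case/orP: Tik => Tik; have Pik := hasse_le hT Tik.
  by rewrite (edge_sides Tik ji jk' (cp_up cp ij jk Pik)).
by rewrite orbC -(edge_sides Tik jk' ji (cp_down cp ij jk Pik)) orbC.
Qed.

Lemma forbidden_up_arc_removed a : forbidden_up_arc T a -> a \notin arcs_of E.
Proof.
case=> j [L [R [l [r [[/imsetP[p jp ->] /imsetP[q jq ->]] LR [lL _] [rR _] ->]]]]].
rewrite !inE in jp jq; rewrite -split_arc_up -/(kept E l r setT).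
have pq : p < q.
  by have := LR => /forall_inP/(_ _ (mem_component _ _ _))/forall_inP/(_ _ (mem_component _ _ _)).
exact: (removed_up_arc cp hT jp jq pq lL rR).
Qed.

Lemma forbidden_down_arc_removed a : forbidden_down_arc T a -> a \notin arcs_of E.
Proof.
case=> j [L [R [l [r [[/imsetP[p jp ->] /imsetP[q jq ->]] LR [lL _] [rR _] ->]]]]].
rewrite !inE in jp jq; rewrite -split_arc_down -/(kept E l r set0).
have pq : p < q.
  by have := LR => /forall_inP/(_ _ (mem_component _ _ _))/forall_inP/(_ _ (mem_component _ _ _)).
rewrite -(component_op T) in lL; rewrite -(component_op T) in rR.
by have := removed_up_arc cpo hTo jp jq pq lL rR; rewrite setCT.
Qed.

End Forward.

Section TreePoset.
Variables (n : nat) (T : rel 'I_n).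
Hypothesis hT : separating_tree T.
Implicit Types (x y z i j k l r c d a b : 'I_n).

Let g := undirected T.
Let gsym : symmetric g := @undirected_sym n T.
Let T_asym x y : T x y -> ~~ T y x. Proof. by case: hT => -[h _] _; apply: h. Qed.
Let g_irr : irreflexive g. Proof. by case: hT => -[_ []]. Qed.
Let g_acyclic (c : seq 'I_n) : ucycle g c -> size c < 3.
Proof. by case: hT => -[_ [_ _ _ _ h]] _; apply: h. Qed.

Lemma tree_irr x : T x x = false.
Proof. by apply/negP => xx; have := T_asym xx; rewrite xx. Qed.

Lemma separating_tree_op : separating_tree (fun x y => T y x).
Proof.
have uE : undirected (fun x y => T y x) =2 undirected T.
  by move=> x y; rewrite /undirected orbC.
case: hT => -[asym [n0 irr sym con acyc]] sep; split.
  split=> [x y|]; first exact: asym.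
  split; first exact: n0.
  - by move=> x; rewrite uE.
  - exact: undirected_sym.
  - by move=> x y; rewrite (eq_connect uE).
  - move=> c; rewrite /ucycle (_ : path.cycle _ c = path.cycle (undirected T) c); first exact: acyc.
    by case: c => //= x c; apply: eq_path.
move=> j; case: (sep j) => h1 h2 h3 h4; split=> // p q pj qj npq;
  rewrite !(component_op T); [exact: h4|exact: h3].
Qed.

(** A directed closed walk contains a cycle, which would have length two. *)
Lemma tree_anti x y : connect T x y -> connect T y x -> x = y.
Proof.
move=> xy yx; apply/eqP; apply: contraT => nxy.
have [c yc cx] : exists2 c, connect T y c & T c x.
  by apply: connect_last => //; rewrite eq_sym.
have /connectP[p0 pp0] := connect_trans xy yc.
case/shortenP: pp0 => p pp up _ cE.
have := g_acyclic (c := x :: p); rewrite /ucycle up /= rcons_path -cE /g /undirected cx andbT.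
rewrite (sub_path _ pp) //; last by move=> a b ->.
move=> /(_ isT); case: p pp up cE => [|a [|//]] /=.
  by move=> _ _ cE; rewrite cE tree_irr in cx.
by rewrite andbT => xa _ cE; rewrite cE (negbTE (T_asym xa)) in cx.
Qed.

Lemma tree_poset : is_poset (connect T).
Proof.
split; first by move=> x; apply: connect0.
  by move=> x y /andP[]; apply: tree_anti.
exact: connect_trans.
Qed.

(** A directed path from [x] to [y] through a third point would reach [y] by
    another child [c], connected to [x] outside [y]. *)
Lemma hasse_tree : T =2 hasse (connect T).
Proof.
move=> x y; apply/idP/idP => [xy|/and3P[nxy xy /forallP h]].
  have nxy : x != y by apply: contraTneq xy => ->; rewrite tree_irr.
  apply/and3P; split; [by []|exact: connect1|].
  apply/forallP => z; apply/implyP => /andP[xz zy]; apply: contraT.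
  rewrite negb_or => /andP[nzx nzy].
  have [c zc cy] := connect_last zy nzy.
  have xc : c \in component T y x.
    apply: connect_component (connect_trans xz zc) => w _ wc.
    apply: contraTneq wc => ->; apply/negP => yc.
    by have := tree_anti yc (connect1 cy) => yE; rewrite yE tree_irr in cy.
  rewrite inE in xc; suff : ~~ connect (avoid g y) x c by rewrite /g xc.
  apply: (no_detour gsym g_acyclic g_irr); rewrite /g /undirected ?xy ?cy ?orbT //.
  by apply: contraNneq nzx => xE; apply/eqP/tree_anti; rewrite // xE.
have /connectP[[|z p] /= pp yE] := xy; first by rewrite yE eqxx in nxy.
case/andP: pp => xz pp.
have zy : connect T z y by apply/connectP; exists p.
have := h z; rewrite (connect1 xz) zy /= => /orP[]/eqP zE; last by rewrite -zE.
by rewrite zE tree_irr in xz.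
Qed.

(** A path that starts upwards either keeps ascending or turns down at some
    point [j], between two children of [j]. *)
Lemma first_turn i a s : path g i (a :: s) -> uniq (i :: a :: s) -> T i a ->
  connect T i (last a s) \/
  exists j c d, [/\ T c j, T d j, c != d, connect T i c & last a s \in component T j d].
Proof.
elim: s i a => [|b s IH] i a; first by move=> _ _ ia; left; apply: connect1.
move=> /=/andP[_ /andP[ab pbs]] uni ia.
have [Tab|nTab] := boolP (T a b).
  have [||//||[j [c [d [cj dj cd ac h]]]]] := IH a b.
  - by rewrite /= ab.
  - by case/andP: uni.
  - by left; apply: connect_trans (connect1 ia) _.
  - by right; exists j, c, d; split=> //; apply: connect_trans (connect1 ia) _.
right; exists a, i, b; split=> //.
- by move: ab; rewrite /g /undirected (negbTE nTab).
- by case/andP: uni => + _; rewrite !inE !negb_or => /and3P[].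
rewrite inE; apply/connectP; exists s => //.
by apply: path_avoid => //; case/and3P: uni.
Qed.

Lemma connect_first a b : connect T a b -> a != b ->
  exists2 c, T a c & connect T c b.
Proof.
case/connectP=> [[|c p]] /=; first by move=> _ ->; rewrite eqxx.
by move=> /andP[ac pp] bE _; exists c => //; apply/connectP; exists p.
Qed.

Lemma child_component i c j : connect T i c -> T c j -> i \in component T j c.
Proof.
move=> ic cj; rewrite component_sym; apply: connect_component ic => z _ zc.
apply: contraTneq zc => ->; apply/negP => jc.
by have := tree_anti jc (connect1 cj) => jE; rewrite jE tree_irr in cj.
Qed.

(** The subtree at [c] is connected without using [j'], which is not in it. *)
Lemma component_avoid j j' c x : c != j -> j' \notin component T j c ->
  x \in component T j c -> x \in component T j' c.
Proof.
move=> cj j'c; rewrite inE => /connectP[s ps xE].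
rewrite inE; apply/connectP; exists s => //.
apply: path_avoid; first exact: path_avoid_sub ps.
by apply: contra j'c => j's; rewrite inE; apply: path_connect ps _ j's.
Qed.

(** A point [x] outside the two descendant subtrees of [j] lies above [j], or
    a path from [j] to [x] turns down at some [j'] above [j]. In the second
    case both subtrees lie on the same side of [j'], and [x] on the other
    one. *)
Lemma between_descendants j c d l r x : T c j -> T d j -> c != d ->
    l \in component T j c -> r \in component T j d ->
    x \notin component T j c -> x \notin component T j d -> l < x < r ->
  connect T j x.
Proof.
move=> cj dj cd lc rd xc xd lxr.
have [->|nxj] := eqVneq x j; first exact: connect0.
have [[_ [_ _ _ con _]] sep] := hT.
have /connectP[p0 pp0] := con j x; case/shortenP: pp0 => p pp up _ xE.
case: p pp up xE => [|a s] pp up xE; first by rewrite xE eqxx in nxj.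
have xa : x \in component T j a.
  rewrite inE; apply/connectP; exists s => //; apply: path_avoid.
    by case/andP: pp.
  by case/andP: up.
have Tja : T j a.
  have /orP[//|aj] : g j a by case/andP: pp.
  have [_ two _ _] := sep j; move: two; rewrite leqNgt => /negP[]; apply/card_gt2P.
  exists a, c, d; rewrite !inE; split; split=> //.
    by apply: contraNneq xc => <-.
  by apply: contraNneq xd => ->.
have [|[j' [d1 [d2 [d1j' d2j' d12 jd1 xd2]]]]] := first_turn pp up Tja.
  by rewrite xE.
rewrite -[last a s]/(last j (a :: s)) -xE in xd2.
have jj' : connect T j j' := connect_trans jd1 (connect1 d1j').
have njj' : j != j'.
  apply: contraTneq jd1 => ->; apply/negP => h.
  by have := tree_anti h (connect1 d1j') => E_; rewrite E_ tree_irr in d1j'.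
have [p jp pj'] := connect_first jj' njj'.
have npj : p != j by apply: contraTneq jp => ->; rewrite tree_irr.
have j'p : j' \in component T j p.
  apply: connect_component pj' => z pz _; apply: contraTneq pz => ->; apply/negP => h.
  by have := tree_anti h (connect1 jp) => E_; rewrite E_ tree_irr in jp.
have sub e y : T e j -> y \in component T j e -> y \in component T j' d1.
  move=> ej ye.
  have nej : e != j by apply: contraTneq ej => ->; rewrite tree_irr.
  have j'e : j' \notin component T j e.
    apply/negP; rewrite component_sym => ej'.
    have := component_trans j'p ej'; rewrite inE; apply/negP.
    apply: (no_detour gsym g_acyclic g_irr); rewrite /g /undirected ?jp ?ej ?orbT //.
    by apply: contraTneq ej => <-; apply: T_asym.
  have nej' : e != j' by apply: contraNneq j'e => <-; apply: mem_component.
  have ej' : e \in component T j' j.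
    by rewrite inE; apply: connect1; rewrite /= /undirected ej orbT njj' nej'.
  apply: component_trans (component_avoid nej j'e ye).
  by apply: component_trans ej'; apply: child_component.
have ld := sub _ _ cj lc; have rd' := sub _ _ dj rd.
have [_ _ _ h] := sep j'.
have side L R y z : separates j' L R -> y \in L -> z \in R -> y < j' < z.
  case/andP=> /forall_inP/(_ y) Lj /forall_inP/(_ j') Rj yL zR.
  have {}Lj := forall_inP (Lj yL) j'; have {}Rj := Rj _.
  by rewrite Lj ?inE //= (forall_inP (Rj _) z) ?inE.
have := h d1 d2; rewrite !inE => /(_ d1j' d2j' d12)/orP[] s12.
  by have := side _ _ _ _ s12 ld xd2; have := side _ _ _ _ s12 rd' xd2; move: lxr; clear; lia.
by have := side _ _ _ _ s12 xd2 ld; have := side _ _ _ _ s12 xd2 rd'; move: lxr; clear; lia.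
Qed.

(** The first turn on the path from [i] to [k] is a point [j] above [i] having
    [i] and [k] in two descendant subtrees; all points between these subtrees
    are above [j], hence above [i]. *)
Lemma forbidden_between i k s a : i < k -> ~~ connect T i k ->
    path g i (a :: s) -> uniq (i :: a :: s) -> last a s = k -> T i a ->
  exists l r, [/\ forbidden_down_arc T (down_arc l r), i <= l, l < r, r <= k
    & forall x, l < x < r -> connect T i x].
Proof.
move=> ik nik pp up kE ia; have [h|] := first_turn pp up ia.
  by rewrite -kE h in nik.
case=> j [c [d [cj dj cd ic kd]]]; rewrite kE in kd.
have iL := child_component ic cj.
have [_ /(_ j)[_ _ _ h]] := hT.
have := h c d; rewrite !inE => /(_ cj dj cd) cdsep.
have [Lj jR] : set_lt (component T j c) [set j] /\ set_lt [set j] (component T j d).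
  case/orP: cdsep => /andP[] // /forall_inP/(_ _ kd)/forall_inP/(_ j) kj.
  move=> /forall_inP/(_ j); rewrite !inE in kj *; move=> /(_ (eqxx _))/forall_inP/(_ _ iL) ji.
  by have := kj (eqxx _); move: ji ik; clear; lia.
have LR x y : x \in component T j c -> y \in component T j d -> x < y.
  move=> xL yR; apply: (@ltn_trans j).
    by have /forall_inP/(_ _ xL)/forall_inP := Lj; apply; rewrite inE.
  by have /forall_inP/(_ j) := jR; rewrite inE => /(_ (eqxx _))/forall_inP; apply.
case: (arg_maxnP (fun x : 'I_n => x : nat) iL) => l lL lmax.
case: (arg_minnP (fun x : 'I_n => x : nat) kd) => r rR rmin.
exists l, r; split.
- exists j, (component T j c), (component T j d), l, r; split=> //.
  + by split; apply: imset_f; rewrite inE.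
  + by apply/forall_inP => x xL; apply/forall_inP => y; apply: LR.
- exact: lmax.
- exact: LR.
- exact: rmin.
- move=> x lxr; apply: connect_trans (connect_trans ic (connect1 cj)) _.
  apply: (between_descendants cj dj cd lL rR) => //.
    by apply/negP => /lmax; move: lxr; clear; lia.
  by apply/negP => /rmin; move: lxr; clear; lia.
Qed.

End TreePoset.

(** * From admissible trees to classes *)

Section Walk.
Variable n : nat.
Implicit Types (s t u : 'S_n) (x y z : 'I_n).

Definition disagreement s t : {set 'I_n * 'I_n} :=
  [set p | bef s p.1 p.2 && bef t p.2 p.1].

(** Among the pairs ordered differently by [t], take one whose entries are the
    closest in [s]: an entry between them would give a closer pair. *)
Lemma walk_step s t : s != t ->
  exists s' x y, [/\ swap s s' x y, bef t y x &
    #|disagreement s' t| < #|disagreement s t|].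
Proof.
move=> st; have [p0 p0P] : exists p, p \in disagreement s t.
  apply/set0Pn; apply: contra st => /eqP/setP d0; apply/eqP/bef_inj => x y.
  have [->|nxy] := eqVneq x y; first by rewrite !bef_irr.
  have := d0 (x, y); have := d0 (y, x); rewrite !inE /=.
  by rewrite (bef_asym s nxy) (bef_asym t nxy); case: (bef s x y); case: (bef t x y).
pose gap (p : 'I_n * 'I_n) : nat := (s^-1%g p.2 - s^-1%g p.1)%N.
case: (@arg_minnP _ p0 (mem (disagreement s t)) gap p0P) => -[x y] /=.
rewrite inE /= => /andP[sxy tyx] gmin.
have [|s' sw] := swap_exists sxy.
  move=> z sxz szy.
  have close a b : bef s a b -> bef t b a -> gap (x, y) <= gap (a, b).
    by move=> sab tba; apply: gmin; rewrite inE /= sab.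
  have zx : z != x by apply: contraTneq sxz => ->; rewrite bef_irr.
  have [tzx|] := boolP (bef t z x).
    by have := close _ _ sxz tzx; move: sxz szy; rewrite /gap /bef /=; clear; lia.
  rewrite -(bef_asym t zx) => txz; have := close _ _ szy (bef_trans tyx txz).
  by move: sxz szy; rewrite /gap /bef /=; clear; lia.
exists s', x, y; split=> //; case: sw => _ s'yx s'E.
apply: proper_card; apply/properP; split.
  apply/subsetP => -[u v]; rewrite !inE /= => /andP[s'uv tvu].
  rewrite tvu andbT -s'E //.
    by apply: contraTneq s'uv => -[-> ->]; apply/negP => /bef_trans/(_ s'yx); rewrite bef_irr.
  by apply: contraTneq tvu => -[-> ->]; apply/negP => /bef_trans/(_ tyx); rewrite bef_irr.
exists (x, y); rewrite inE /= ?sxy // negb_and; apply/orP; left.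
by apply/negP => /bef_trans/(_ s'yx); rewrite bef_irr.
Qed.

End Walk.

Section Backward.
Variables (n : nat) (E : rel 'S_n) (T : rel 'I_n).
Hypothesis hE : lattice_congruence E.
Hypothesis hT : separating_tree T.
Hypothesis hadm : admissible E T.
Implicit Types (s t : 'S_n) (x y z i j k l r : 'I_n).

Let P : rel 'I_n := connect T.
Let Ppo : is_poset P := tree_poset hT.
Let lext := is_linear_extension P.

Let lext_bef s x y : lext s -> P x y -> x != y -> bef s x y.
Proof. by move=> /linear_extensionP h xy nxy; apply: h. Qed.

Let lext_incomparable s x y : lext s -> bef s x y -> ~~ P y x.
Proof.
move=> sP sxy; have nyx : y != x by apply: contraTneq sxy => ->; rewrite bef_irr.
apply/negP => /(lext_bef sP)/(_ nyx)/bef_trans/(_ sxy).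
by rewrite bef_irr.
Qed.

(** Consecutive comparable entries form an edge, and the points they surround
    lie on the sides prescribed by its mandatory arc. *)
Lemma consecutive_edge_kept s t x y i k : lext s -> swap s t x y -> P x y ->
    i < k -> (i, k) = (x, y) \/ (i, k) = (y, x) ->
  kept E i k [set z | bef s z x].
Proof.
move=> sP sw Pxy ik ikxy; have nxy := swap_neq sw; have [sxy tyx _] := sw.
have Txy : T x y.
  rewrite (hasse_tree hT) /hasse nxy [connect T x y]Pxy; apply/forallP => z.
  apply/implyP => /andP[xz zy]; apply: contraT; rewrite negb_or => /andP[zx zy'].
  have sxz : bef s x z by apply: lext_bef; rewrite // eq_sym.
  have := lext_bef sP zy zy'; rewrite -(swap_gap sw) // => szx.
  by have := bef_trans sxz szx; rewrite bef_irr.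
have Tik : undirected T i k.
  by rewrite /undirected; case: ikxy => -[-> ->]; rewrite Txy ?orbT.
have [mand _ _] := hadm.
pose A := [set j in open_itv i k | connect T j i || connect T j k].
pose B := [set j in open_itv i k | connect T i j || connect T k j].
have arcAB : (i, k, A, B) \in arcs_of E by apply: mand; exists i, k.
have : is_arc (i, k, A, B) by move: arcAB; rewrite inE => /andP[].
case/and3P=> _ /eqP AB /disjoint_setI0 AB0.
have neq z : i < z < k -> z != x /\ z != y.
  move=> h; have : (z != i) && (z != k) by rewrite !ord_eqE; move: h; clear; lia.
  by case/andP; case: ikxy => -[-> ->].
have inA z : z \in A -> i < z < k /\ bef s z x.
  rewrite !inE => /andP[izk zik]; split=> //; have [nzx nzy] := neq z izk.
  have /orP[h|h] : P z x || P z y by case: ikxy zik => -[-> ->] //; rewrite orbC.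
    exact: lext_bef.
  by rewrite (swap_gap sw) //; apply: lext_bef.
have inB z : z \in B -> i < z < k /\ ~~ bef s z x.
  rewrite !inE => /andP[izk zik]; split=> //; have [nzx nzy] := neq z izk.
  have /orP[h|h] : P x z || P y z by case: ikxy zik => -[-> ->] //; rewrite orbC.
    by rewrite -bef_asym //; apply: lext_bef; rewrite // eq_sym.
  by rewrite (swap_gap sw) // -bef_asym //; apply: lext_bef; rewrite // eq_sym.
suff [AE BE] : open_itv i k :&: [set z | bef s z x] = A /\
               open_itv i k :\: [set z | bef s z x] = B.
  by rewrite /kept /split_arc AE BE.
have zD z : (z \in [set z | bef s z x]) = bef s z x by rewrite inE.
clearbody A B; split; apply/setP => z; rewrite -AB ?in_setI ?in_setD in_setU zD.
  apply/idP/idP => [/andP[/orP[//|/inB[_ /negP]]//]|zA].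
  by rewrite zA; case: (inA z zA) => _ ->.
apply/idP/idP => [/andP[nb /orP[/inA[_ b]|//]]|zB]; first by rewrite b in nb.
by rewrite zB orbT andbT; case: (inB z zB).
Qed.

(** A tree path between incomparable entries turns, and its first turn gives a
    forbidden arc inside the arc of the two entries. *)
Lemma consecutive_incomparable_removed s t x y i k :
    lext s -> swap s t x y -> ~~ P x y ->
    i < k -> (i, k) = (x, y) \/ (i, k) = (y, x) ->
  ~~ kept E i k [set z | bef s z x].
Proof.
move=> sP sw nPxy ik ikxy; have nxy := swap_neq sw; have [sxy tyx _] := sw.
have nPyx := lext_incomparable sP sxy.
have [nik nki] : ~~ P i k /\ ~~ P k i by case: ikxy => -[-> ->].
have [_ forbU forbD] := hadm.
have neq z : i < z < k -> z != x /\ z != y.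
  move=> h; have : (z != i) && (z != k) by rewrite !ord_eqE; move: h; clear; lia.
  by case/andP; case: ikxy => -[-> ->].
have after z : i < z < k -> P i z -> ~~ bef s z x.
  move=> /neq[zx zy] iz; have /orP[h|h] : P x z || P y z.
  - by case: ikxy iz => -[-> _] ->; rewrite ?orbT.
  - by rewrite -bef_asym //; apply: lext_bef; rewrite // eq_sym.
  by rewrite (swap_gap sw) // -bef_asym //; apply: lext_bef; rewrite // eq_sym.
have before z : i < z < k -> P z i -> bef s z x.
  move=> /neq[zx zy] iz; have /orP[h|h] : P z x || P z y.
  - by case: ikxy iz => -[-> _] ->; rewrite ?orbT.
  - exact: lext_bef.
  by rewrite (swap_gap sw) //; apply: lext_bef.
have [[_ [_ _ _ con _]] _] := hT.
have /connectP[p0 pp0] := con i k; case/shortenP: pp0 => p pp up _ kE.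
case: p pp up kE => [|a q] pp up /esym kE.
  by move: ik; rewrite -kE ltnn.
have /orP[ia|ai] : undirected T i a by case/andP: pp.
  have [l [r [/forbD forb il lr rk h]]] := forbidden_between hT ik nik pp up kE ia.
  apply: contra forb => /(kept_sub hE il lr rk).
  rewrite -split_arc_down -/(kept E l r set0) (@kept_ext _ E l r _ set0) //.
  move=> z /andP[lz zr]; rewrite !inE; apply/negbTE/after; last by apply: h; rewrite lz.
  by rewrite (leq_ltn_trans il) // (leq_trans zr).
have ppo : path (undirected (fun u v => T v u)) i (a :: q).
  by rewrite (eq_path (e' := undirected T)) // => u v; rewrite /undirected orbC.
have opE u v : connect (fun u v => T v u) u v = connect T v u by rewrite (connect_rev T).
have [|l [r [forb0 il lr rk h]]] :=
  forbidden_between (separating_tree_op hT) ik _ ppo up kE ai; first by rewrite opE.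
have forb : up_arc l r \notin arcs_of E.
  apply: forbU; case: forb0 => j [L [R [l' [r' [[LA RA] LR lm rm [-> ->]]]]]].
  exists j, L, R, l', r'; split=> //; split.
    case/imsetP: LA => c; rewrite inE => cj ->; rewrite (component_op T).
    by apply: imset_f; rewrite inE.
  case/imsetP: RA => c; rewrite inE => cj ->; rewrite (component_op T).
  by apply: imset_f; rewrite inE.
apply: contra forb => /(kept_sub hE il lr rk).
rewrite -split_arc_up -/(kept E l r setT) (@kept_ext _ E l r _ setT) //.
move=> z /andP[lz zr]; rewrite !inE; apply/before; last by rewrite /P -opE; apply: h; rewrite lz.
by rewrite (leq_ltn_trans il) // (leq_trans zr).
Qed.

(** The two previous lemmas, in a form insensitive to the order of the values
    [x] and [y]. *)
Lemma cong_swap_lext s t x y : lext s -> swap s t x y -> E s t <-> lext t.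
Proof.
move=> sP sw; have nxy := swap_neq sw; pose D := [set z | bef s z x].
have DE z : (z \in D) = bef s z x by rewrite inE.
have [i [k [ik ikxy EE]]] : exists i k,
    [/\ i < k, (i, k) = (x, y) \/ (i, k) = (y, x) & E s t = ~~ kept E i k D].
  have /orP[xy|yx] : (x < y) || (y < x) by rewrite -neq_ltn -ord_eqE.
    exists x, y; split=> //; first by left.
    by apply: (cong_swap hE sw xy) => z _ _; rewrite DE.
  exists y, x; split=> //; first by right.
  by apply: (cong_swap_down hE sw yx) => z _ _; rewrite DE.
rewrite EE; have [Pxy|nPxy] := boolP (P x y).
  rewrite (consecutive_edge_kept sP sw Pxy ik ikxy); split=> // tP.
  by have := lext_incomparable tP (let: And3 _ h _ := sw in h); rewrite Pxy.
rewrite (consecutive_incomparable_removed sP sw nPxy ik ikxy); split=> // _.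
exact: swap_linear_extension sP sw nPxy.
Qed.

(** Swaps towards [t] exchange incomparable entries, so they stay among the
    linear extensions. *)
Lemma lext_cong s t : lext s -> lext t -> E s t.
Proof.
have [m] := ubnP #|disagreement s t|; elim: m s => // m IH s dm sP tP.
have [->|st] := eqVneq s t; first exact: cong_refl.
have [s' [x [y [sw tyx ds']]]] := walk_step st.
have s'P : lext s'.
  exact: swap_linear_extension sP sw (lext_incomparable tP tyx).
apply: (cong_trans hE) ((cong_swap_lext sP sw).2 s'P) _.
by apply: IH => //; apply: leq_trans ds' _.
Qed.

(** Classes are convex, so comparable members are joined by cover relations
    inside the class. *)
Lemma cong_lext_le s t :
  weak_le s t || weak_le t s -> E s t -> lext s -> lext t.
Proof.
have [m] := ubnP #|disagreement s t|; elim: m s => // m IH s dm le st sP.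
have [<-//|nst] := eqVneq s t.
have [s' [x [y [sw tyx ds']]]] := walk_step nst.
have nxy := swap_neq sw; have [sxy s'yx s'E] := sw.
have nt : ~~ bef t x y by apply/negP => /bef_trans/(_ tyx); rewrite bef_irr.
have ns' : ~~ bef s' x y by apply/negP => /bef_trans/(_ s'yx); rewrite bef_irr.
have ns : ~~ bef s y x by apply/negP => /bef_trans/(_ sxy); rewrite bef_irr.
suff [le' ss'] : (weak_le s' t || weak_le t s') /\ E s s'.
  apply: (IH s') => //; first exact: leq_trans ds' _.
    by apply: (cong_trans hE) st; rewrite (cong_sym hE).
  exact/(cong_swap_lext sP sw).
have [xy|yx] : x < y \/ y < x.
- by apply/orP; rewrite -neq_ltn -ord_eqE.
- have {}le : weak_le s t.
    case/orP: le => // /weak_leP/(_ _ _ xy tyx) h; by rewrite h in ns.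
  have s't : weak_le s' t.
    apply/weak_leP => u v vu s'uv.
    have [[-> ->]//|n1] := eqVneq (u, v) (y, x).
    have n2 : (u, v) != (x, y) by apply: contraNneq ns' => -[<- <-].
    by apply: (weak_leP _ _ le) => //; rewrite -s'E.
  rewrite s't; split=> //.
  exact: (cong_convex hE (swap_weak_le sw xy) s't st).
have {}le : weak_le t s.
  case/orP: le => // /weak_leP/(_ _ _ yx sxy) h; by rewrite h in nt.
have ts' : weak_le t s'.
  apply/weak_leP => u v vu tuv.
  have n1 : (u, v) != (x, y) by apply: contraNneq nt => -[<- <-].
  have n2 : (u, v) != (y, x).
    by apply: contraTneq vu => -[-> ->]; rewrite -leqNgt ltnW.
  by rewrite s'E //; apply: (weak_leP _ _ le).
rewrite ts' orbT; split=> //.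
have s's := swap_weak_le (swap_sym sw) yx.
apply: (cong_trans hE) (st) _; apply: (cong_convex hE ts' s's).
by rewrite (cong_sym hE).
Qed.

(** Two members of a class are joined through their meet, which is in the class
    and comparable with both. *)
Lemma admissible_congruence_poset : congruence_poset E P.
Proof.
split=> //; have [s sP] := linear_extension_exists Ppo; exists s => t.
split=> [st|tP]; last exact: lext_cong.
have [m mE] := meet_exists s t.
have sm : E s m.
  have := cong_meet hE st (is_meet_le (weak_le_refl s)) (is_meetC mE); exact.
have [ms mt _] := mE.
apply: (@cong_lext_le m); first by rewrite mt.
  by apply: (cong_trans hE) st; rewrite (cong_sym hE).
by apply: cong_lext_le sm sP; rewrite ms orbT.
Qed.

End Backward.

Theorem proposition3p16 (n : nat) (hn : 1 <= n) (E : rel 'S_n)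
    (hE : lattice_congruence E) (hsimple : simple_congruence E)
    (hess : essential E) (T : rel 'I_n) :
  (exists P : rel 'I_n, congruence_poset E P /\ T =2 hasse P) <->
  (separating_tree T /\ admissible E T).
Proof.
split=> [[P [hP hT]]|[hT hadm]].
  split; first exact: (hasse_separating_tree hn hE hsimple hess hP hT).
  split=> a.
  - exact: (mandatory_arc_kept hE hsimple hess hP hT).
  - exact: (forbidden_up_arc_removed hE hsimple hess hP hT).
  - exact: (forbidden_down_arc_removed hE hsimple hess hP hT).
exists (connect T); split; first exact: admissible_congruence_poset.
exact: hasse_tree.
Qed.
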